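(* Let $q\in(0,1)$, $\sigma>0$, $k>0$, $L\ge2$, $\Lambda_L=\{1,\dots,L\}$. (a) The process Th-ASIP$(q,k)$ on $\Lambda_L$ is self-dual with self-duality function $$D_{(L)}(\eta,\xi)=\prod_{i=1}^L \frac{\binom{\eta_i}{\xi_i}_q}{\binom{\xi_i+2k-1}{\xi_i}_q}\; q^{(\eta_i-\xi_i)\left[2\sum_{m=1}^{i-1}\xi_m+\xi_i\right]-4ki\xi_i}\;\mathbf 1_{\xi_i\le\eta_i},\qquad\eta,\xi\in\mathbb N^{\Lambda_L}.$$ (b) The process Th-ABEP$(\sigma,k)$ on $\Lambda_L$ is dual to the process Th-SIP$(k)$ on $\Lambda_L$, with duality function $$D^\sigma_{(L)}(x,\xi)=\prod_{i=1}^L\frac{\Gamma(2k)}{\Gamma(2k+\xi_i)}\left(\frac{e^{-2\sigma E_{i+1}(x)}-e^{-2\sigma E_i(x)}}{2\sigma}\right)^{\xi_i},\qquad x\in[0,\infty)^L,\ \xi\in\mathbb N^{\Lambda_L},$$ where $E_i(x)=\sum_{\ell=i}^Lx_\ell$ and $E_{L+1}(x)=0$.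
   Context: $\mathbb N=\{0,1,2,\dots\}$. Two Markov processes $X_t$ on $\Omega$ and $\widehat X_t$ on $\widehat\Omega$ are dual with duality function $D:\Omega\times\widehat\Omega\to\mathbb R$ if $\mathbb E_x[D(X_t,\hat x)]=\widehat{\mathbb E}_{\hat x}[D(x,\widehat X_t)]$ for all $x\in\Omega$, $\hat x\in\widehat\Omega$, $t>0$; self-dual means $\widehat X_t$ has the same generator as $X_t$. For real $a$, $[a]_q=\frac{q^a-q^{-a}}{q-q^{-1}}$; $[n]_q!=[n]_q\cdots[1]_q$; $\binom nm_q=\frac{[n]_q!}{[m]_q![n-m]_q!}$ for integers; $\binom{n+2k-1}{n}_q=\prod_{m=1}^n\frac{[2k-1+m]_q}{[m]_q}$. Th-ASIP$(q,k)$: the Markov jump process on $\mathbb N^{\Lambda_L}$ with generator $$f\mapsto\sum_{i=1}^{L-1}\sum_{r=0}^{\eta_i+\eta_{i+1}}\big[f(\eta_1,\dots,\eta_{i-1},r,\eta_i+\eta_{i+1}-r,\eta_{i+2},\dots,\eta_L)-f(\eta)\big]\,\nu^{ASIP}_{q,k}(r\,|\,\eta_i+\eta_{i+1}),$$ where $\nu^{ASIP}_{q,k}(\cdot\,|\,n)$ is the probability mass function on $\{0,\dots,n\}$ proportional to $r\mapsto q^{-4kr}\binom{r+2k-1}{r}_q\binom{2k+n-r-1}{n-r}_q$. Th-SIP$(k)$: the Markov jump process on $\mathbb N^{\Lambda_L}$ with the generator of the same form, where $\nu^{ASIP}_{q,k}(\cdot|n)$ is replaced by the Beta-Binomial probability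 mass function with parameters $(n,2k,2k)$, i.e. $\nu^{SIP}_k(r|n)=\binom nr\frac{\mathrm{Beta}(r+2k,\,n-r+2k)}{\mathrm{Beta}(2k,2k)}$, $r\in\{0,\dots,n\}$. Th-ABEP$(\sigma,k)$: the Markov jump process on $[0,\infty)^L$ with generator $$f\mapsto\sum_{i=1}^{L-1}\int_0^1\big[f(x_1,\dots,x_{i-1},w(x_i+x_{i+1}),(1-w)(x_i+x_{i+1}),x_{i+2},\dots,x_L)-f(x)\big]\,\nu_{\sigma,k}(w|x_i+x_{i+1})\,dw,$$ where, for $E>0$, $\nu_{\sigma,k}(\cdot|E)$ is the probability density on $[0,1]$ proportional to $w\mapsto e^{2\sigma Ew}\big\{(e^{2\sigma Ew}-1)(1-e^{-2\sigma E(1-w)})\big\}^{2k-1}$ (when $x_i+x_{i+1}=0$ the $i$-th term is zero). *)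

(* Defs.v *)
From HB Require Import structures.
From mathcomp Require Import all_boot all_order all_algebra.
From mathcomp Require Import all_classical all_reals all_analysis.
From mathcomp Require Import measurable_realfun.

Set Implicit Arguments.
Unset Strict Implicit.
Unset Printing Implicit Defensive.

Import Order.TTheory GRing.Theory Num.Theory.
Import numFieldNormedType.Exports.

Local Open Scope classical_set_scope.
Local Open Scope ring_scope.

(* A time-homogeneous Markov process [mp_path] with state space [S] (a subset
   of the measurable type [T]), as a family of laws [mp_law x] indexed by the
   starting point [x] on a common sample space.  Time is [t : R] with
   [0 <= t]; [mp_law x] is irrelevant when [x] is outside [S]. *)
Record markov_process (R : realType) (d : measure_display)
    (T : measurableType d) (S : set T) := MarkovProcess {
  mp_display : measure_display ;
  mp_space : measurableType mp_display ;
  mp_law : T -> probability mp_space R ;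
  mp_path : R -> mp_space -> T ;
  mp_measurable : forall t : R, 0 <= t -> measurable_fun setT (mp_path t) ;
  mp_state : forall (t : R) (w : mp_space), 0 <= t -> S (mp_path t w) ;
  mp_start : forall x : T, S x ->
    {ae mp_law x, forall w, mp_path 0 w = x} ;
  mp_kernel : forall (t : R) (A : set T), 0 <= t -> measurable A ->
    measurable_fun S (fun x => mp_law x (mp_path t @^-1` A)) ;
  (* The Markov property with respect to the natural filtration:
     P_x(F, X_{s+t} \in A) = E_x[1_F P_{X_s}(X_t \in A)]. *)
  mp_markov : forall (x : T) (s t : R) (F : set mp_space) (A : set T),
    S x -> 0 <= s -> 0 <= t ->
    <<s [set B | exists u : R, exists C : set T,
          [/\ 0 <= u <= s, measurable C & B = mp_path u @^-1` C] ] >> F ->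
    measurable A ->
    mp_law x (F `&` mp_path (s + t) @^-1` A) =
    (\int[mp_law x]_(w in F) mp_law (mp_path s w) (mp_path t @^-1` A))%E
}.

Arguments mp_law {R d T S} _ _.
Arguments mp_path {R d T S} _ _ _.

Section MarkovProcesses.
Context {R : realType} {d : measure_display} {T : measurableType d}.
Implicit Types (S : set T) (G : (T -> R) -> T -> R).

(* The local conditions say that the path is right-continuous, piecewise
   constant, with finitely many jumps in every bounded time interval. *)
Definition jump_path (p : R -> T) : Prop :=
  (forall t : R, 0 <= t -> \forall s \near t^'+, p s = p t) /\
  (forall t : R, 0 < t -> exists y : T, \forall s \near t^'-, p s = y).

(* [G] is the infinitesimal generator of the semigroup of [X] on the space of
   bounded measurable functions on [S] with the supremum norm, and is defined
   on the whole of that space. *)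
Definition has_bounded_generator S (X : markov_process R S) G : Prop :=
  forall f : T -> R, measurable_fun S f ->
    (exists M : R, forall x, S x -> `|f x| <= M) ->
    forall e : R, 0 < e -> \forall t \near (0 : R)^'+, forall x, S x ->
      `|(fine ('E_(mp_law X x)[fun w => f (mp_path X t w)])%E - f x) / t - G f x|
        <= e.

Definition markov_jump_process_with_generator S (X : markov_process R S) G :
    Prop :=
  (forall x, S x ->
     {ae mp_law X x, forall w, jump_path (fun t => mp_path X t w)}) /\
  has_bounded_generator X G.

(* Integrability is required because the integral of a non-integrable function
   takes a default value. *)
Definition dual_with (d' : measure_display) (T' : measurableType d')
    S (S' : set T') (X : markov_process R S) (Y : markov_process R S')
    (D : T -> T' -> R) : Prop :=
  forall (x : T) (y : T') (t : R), S x -> S' y -> 0 < t ->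
  [/\ (mp_law X x).-integrable setT (fun w => (D (mp_path X t w) y)%:E),
      (mp_law Y y).-integrable setT (fun w => (D x (mp_path Y t w))%:E) &
      ('E_(mp_law X x)[fun w => D (mp_path X t w) y] =
       'E_(mp_law Y y)[fun w => D x (mp_path Y t w)])%E ].

End MarkovProcesses.

Section SpecialFunctions.
Context {R : realType}.
Implicit Types (q k a b z : R) (n m : nat).

Definition qnum q a : R := (q `^ a - q `^ (- a)) / (q - q^-1).

Definition qfact q n : R := \prod_(1 <= m < n.+1) qnum q m%:R.

(* Meaningful for [m <= n] only. *)
Definition qbinom q n m : R := qfact q n / (qfact q m * qfact q (n - m)).

(* The q-binomial coefficient "n + 2k - 1 choose n" for real [k]. *)
Definition qbinom2k q k n : R :=
  \prod_(1 <= m < n.+1) (qnum q (2 * k - 1 + m%:R) / qnum q m%:R).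

Definition Gamma z : R :=
  \int[lebesgue_measure]_(t in `]0, +oo[) (t `^ (z - 1) * expR (- t)).

Definition Beta a b : R :=
  \int[lebesgue_measure]_(t in `]0, 1[) (t `^ (a - 1) * (1 - t) `^ (b - 1)).

End SpecialFunctions.

Section Processes.
Context {R : realType} {L : nat}.
Implicit Types (q sigma k : R) (eta xi : L.-tuple nat) (x : L.-tuple R).

(* Sites 1, ..., L are represented by positions 0, ..., L - 1. *)
Definition set_bond (A : Type) (x : L.-tuple A) (i : nat) (a b : A) :
    L.-tuple A :=
  [tuple if (j : nat) == i then a
         else if (j : nat) == i.+1 then b else tnth x j | j < L].

Definition particle_generator (nu : nat -> nat -> R)
    (f : L.-tuple nat -> R) eta : R :=
  \sum_(i < L.-1)
    let n := (nth 0%N eta i + nth 0%N eta i.+1)%N in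
    \sum_(r < n.+1) (f (set_bond eta i r (n - r)%N) - f eta) * nu r n.

Definition nu_ASIP_weight q k (r n : nat) : R :=
  q `^ (- (4 * k * r%:R)) * qbinom2k q k r * qbinom2k q k (n - r).

Definition nu_ASIP q k (r n : nat) : R :=
  nu_ASIP_weight q k r n / \sum_(s < n.+1) nu_ASIP_weight q k s n.

Definition nu_SIP k (r n : nat) : R :=
  'C(n, r)%:R * (Beta (r%:R + 2 * k) ((n - r)%:R + 2 * k)
                 / Beta (2 * k) (2 * k)).

Definition nu_ABEP_weight sigma k (w E : R) : R :=
  expR (2 * sigma * E * w) *
  ((expR (2 * sigma * E * w) - 1) *
   (1 - expR (- (2 * sigma * E * (1 - w))))) `^ (2 * k - 1).

Definition nu_ABEP sigma k (w E : R) : R :=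
  nu_ABEP_weight sigma k w E /
  \int[lebesgue_measure]_(u in `[0, 1]) nu_ABEP_weight sigma k u E.

Definition ABEP_generator sigma k (f : L.-tuple R -> R) x : R :=
  \sum_(i < L.-1)
    let E := nth 0 x i + nth 0 x i.+1 in
    if E == 0 then 0 else
    \int[lebesgue_measure]_(w in `[0, 1])
      ((f (set_bond x i (w * E) ((1 - w) * E)) - f x) * nu_ABEP sigma k w E).

Definition nonneg_configs : set (L.-tuple R) :=
  [set x | forall i, 0 <= tnth x i].

Definition is_ThASIP q k (X : markov_process R [set: L.-tuple nat]) : Prop :=
  markov_jump_process_with_generator X (particle_generator (nu_ASIP q k)).

Definition is_ThSIP k (X : markov_process R [set: L.-tuple nat]) : Prop :=
  markov_jump_process_with_generator X (particle_generator (nu_SIP k)).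

Definition is_ThABEP sigma k (X : markov_process R nonneg_configs) : Prop :=
  markov_jump_process_with_generator X (ABEP_generator sigma k).

Definition D_ASIP q k eta xi : R :=
  \prod_(i < L)
    (qbinom q (tnth eta i) (tnth xi i) / qbinom2k q k (tnth xi i) *
     q `^ (((tnth eta i)%:R - (tnth xi i)%:R) *
             (2 * (\sum_(m < L | (m < i)%N) (tnth xi m)%:R) + (tnth xi i)%:R)
           - 4 * k * i.+1%:R * (tnth xi i)%:R) *
     (tnth xi i <= tnth eta i)%N%:R).

(* The sum of the components at positions [i] and beyond; it is 0 for
   [i = L]. *)
Definition tail_energy x (i : nat) : R := \sum_(l < L | (i <= l)%N) tnth x l.

Definition D_ABEP sigma k x xi : R :=
  \prod_(i < L)
    (Gamma (2 * k) / Gamma (2 * k + (tnth xi i)%:R) *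
     ((expR (- (2 * sigma * tail_energy x i.+1)) -
       expR (- (2 * sigma * tail_energy x i))) / (2 * sigma))
       ^+ (tnth xi i)).

End Processes.

(* Main.v *)
(** The generators are bounded, so the semigroups can be compared without
    exponentials.  If the two generators agree on the duality function [D], acting
    on one variable each, then the two semigroups agree on [D] up to [o(h)] at
    time [h], uniformly; splitting [t] into [n] steps and using the semigroup
    property gives equality at time [t].  The unboundedness of [D] is harmless: a
    particle process conserves its number of particles, so it almost surely stays
    in a finite set of configurations, on which its semigroup is a stochastic
    matrix.

    The generators act bond by bond, which reduces their duality to two sites.
    For ASIP both sides of the two-site identity are q-Vandermonde convolutions,
    one with positive parameters (thermalizing the process) and one with negative
    integer parameters (thermalizing the dual).  For ABEP, along the curve
    [y(w) = (exp(- s (1 - w)) - exp(- s)) / (1 - exp(- s))] with [s = 2 sigma E]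
    the redistribution density is the Beta density [(y (1 - y))^(2k - 1) y'] and
    the two factors of the duality function are powers of [y] and [1 - y].  Its
    moments follow from integrating the derivative of [y^a (1 - y)^b], without
    substitution in the integral, and so do the Beta-Binomial weights (for the
    curve [y(w) = w]); on the dual side the sum is the binomial theorem. *)

Require Import Defs.
From mathcomp Require Import all_boot all_order all_algebra.
From mathcomp Require Import all_classical all_reals all_analysis.
From mathcomp Require Import measurable_realfun giry.
From mathcomp Require Import ring lra zify.
Import Order.TTheory GRing.Theory Num.Theory.
Import numFieldNormedType.Exports.
Set Implicit Arguments.
Unset Strict Implicit.
Unset Printing Implicit Defensive.
Local Open Scope classical_set_scope.
Local Open Scope ring_scope.

(** * Semigroup of a Markov process *)

(** The transition semigroup. [fine] sends a non-finite expectation to 0, so a value stands for an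
    expectation only where integrability is known. *)
Definition markov_op (R : realType) (d : measure_display)
    (T : measurableType d) (S : set T) (X : markov_process R S) (t : R)
    (f : T -> R) (x : T) : R :=
  fine ('E_(mp_law X x)[fun w => f (mp_path X t w)])%E.

Section Semigroup.
Context {R : realType} {d : measure_display} {T : measurableType d}.
Context {S : set T} {X : markov_process R S}.
Hypothesis mS : measurable S.
Implicit Types (s t M : R) (f g : T -> R) (x : T).

Lemma measurable_comp_path t f : 0 <= t -> measurable_fun S f ->
  measurable_fun setT (fun w => f (mp_path X t w)).
Proof.
move=> t0 mf; apply: (measurable_comp (F := S)) => //.
- by move=> _ [w _ <-]; exact: mp_state.
- exact: mp_measurable.
Qed.

Lemma integrable_comp_path t f M x : 0 <= t -> measurable_fun S f ->
  (forall y, S y -> `|f y| <= M) ->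
  (mp_law X x).-integrable setT (fun w => (f (mp_path X t w))%:E).
Proof.
move=> t0 mf fM.
apply: (le_integrable measurableT _ _
  (finite_measure_integrable_cst (mp_law X x) M measurableT)) => //.
- by apply/measurable_EFinP; exact: measurable_comp_path.
- move=> w _ /=; rewrite lee_fin.
  apply: (le_trans (fM _ _)); first exact: mp_state.
  exact: ler_norm.
Qed.

Lemma expectation_comp_path t f M x : 0 <= t -> measurable_fun S f ->
  (forall y, S y -> `|f y| <= M) ->
  ('E_(mp_law X x)[fun w => f (mp_path X t w)] = (markov_op X t f x)%:E)%E.
Proof.
move=> t0 mf fM; rewrite /markov_op fineK//.
rewrite unlock; apply: integrable_fin_num => //.
exact: integrable_comp_path fM.
Qed.

Lemma markov_opE t f x :
  markov_op X t f x = \int[mp_law X x]_w f (mp_path X t w).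
Proof. by rewrite /markov_op unlock. Qed.

Lemma eq_markov_op t f g x : 0 <= t -> {in S, f =1 g} ->
  markov_op X t f x = markov_op X t g x.
Proof.
move=> t0 fg; rewrite !markov_opE; apply: eq_Rintegral => w _.
by apply: fg; rewrite inE; exact: mp_state.
Qed.

Lemma markov_op_cst t (c : R) x : markov_op X t (cst c) x = c.
Proof.
rewrite markov_opE Rintegral_cst//.
by rewrite [X in fine X](_ : _ = 1%E) ?mulr1//; exact: probability_setT.
Qed.

Lemma markov_opD t f g M N x : 0 <= t ->
  measurable_fun S f -> (forall y, S y -> `|f y| <= M) ->
  measurable_fun S g -> (forall y, S y -> `|g y| <= N) ->
  markov_op X t (fun y => f y + g y) x = markov_op X t f x + markov_op X t g x.
Proof.
move=> t0 mf fM mg gN; rewrite !markov_opE RintegralD//.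
- exact: integrable_comp_path fM.
- exact: integrable_comp_path gN.
Qed.

Lemma markov_opZ t (c : R) f M x : 0 <= t ->
  measurable_fun S f -> (forall y, S y -> `|f y| <= M) ->
  markov_op X t (fun y => c * f y) x = c * markov_op X t f x.
Proof.
move=> t0 mf fM; rewrite !markov_opE RintegralZl//.
exact: integrable_comp_path fM.
Qed.

Lemma ler_norm_markov_op t f M x : 0 <= t -> measurable_fun S f ->
  (forall y, S y -> `|f y| <= M) -> `|markov_op X t f x| <= M.
Proof.
move=> t0 mf fM; rewrite markov_opE.
have fi := integrable_comp_path x t0 mf fM.
apply: (le_trans (le_normr_Rintegral _ fi)) => //.
rewrite -[leRHS](markov_op_cst t M x) markov_opE.
apply: le_Rintegral => //.
- exact: integrable_norm fi.
- exact: finite_measure_integrable_cst.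
- by move=> w _; apply: fM; exact: mp_state.
Qed.

(** The one-time law as a point of the Giry space, so that Chapman-Kolmogorov becomes an equality
    between a bind and such a law. *)
Definition path_law t (t0 : 0 <= t) x : giry T R :=
  giry_map (mp_measurable (m := X) t0) (mp_law X x).

Lemma measurable_path_law t (t0 : 0 <= t) : measurable_fun S (path_law t0).
Proof.
apply: measurable_giry_codensity => // B mB.
exact: mp_kernel.
Qed.

Lemma path_law_int t (t0 : 0 <= t) x f : measurable_fun setT f ->
  (forall y, 0 <= f y) ->
  giry_int (path_law t0 x) (EFin \o f) =
  ('E_(mp_law X x)[fun w => f (mp_path X t w)])%E.
Proof.
move=> mf f0; by rewrite giry_int_map ?unlock//; exact/measurable_EFinP.
Qed.

(* The Chapman-Kolmogorov equation is available for nonnegative functions on the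
   whole space only: hence the shift, and the extension by 0 outside [S]. *)
Let shift M f : T -> R := (fun y => f y + M) \_ S.

Let shift_ge0 M f y : (forall y, S y -> `|f y| <= M) -> 0 <= shift M f y.
Proof.
move=> fM; rewrite /shift patchE; case: ifPn => // /set_mem Sy.
by have := fM _ Sy; rewrite ler_norml => /andP[? _]; lra.
Qed.

Let measurable_shift M f : measurable_fun S f ->
  measurable_fun setT (shift M f).
Proof.
move=> mf; apply/(measurable_restrictT _ mS).
by apply: measurable_funD => //; exact: measurable_cst.
Qed.

Let markov_op_shift t M f x : 0 <= t -> measurable_fun S f ->
  (forall y, S y -> `|f y| <= M) ->
  markov_op X t (shift M f) x = markov_op X t f x + M.
Proof.
move=> t0 mf fM.
rewrite (eq_markov_op (g := fun y => f y + M))//; last first.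
  by move=> y yS; rewrite /shift patchE yS.
by rewrite (markov_opD (M := M) (N := `|M|) (g := cst M))// markov_op_cst.
Qed.

Let shift_le M f y : S y -> (forall y, S y -> `|f y| <= M) -> `|shift M f y| <= M + M.
Proof.
move=> Sy fM; rewrite ger0_norm ?shift_ge0//.
rewrite /shift patchE mem_set//.
by have := fM _ Sy; rewrite ler_norml => /andP[_ ?]; lra.
Qed.

(** The law at time [t] depends measurably on the starting point, and integrating a fixed
    nonnegative function is measurable on the Giry space; the shift is subtracted at the end. *)
Lemma measurable_markov_op t f M : 0 <= t -> measurable_fun S f ->
  (forall y, S y -> `|f y| <= M) -> measurable_fun S (markov_op X t f).
Proof.
move=> t0 mf fM.
have -> : markov_op X t f = (fun x => fine (giry_int (path_law t0 x)
    (EFin \o shift M f)) - M).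
  apply/funext => x; rewrite path_law_int//.
  - rewrite -/(markov_op X t _ x) markov_op_shift//; ring.
  - exact: measurable_shift.
  - by move=> y; exact: shift_ge0.
apply: measurable_funB => //.
apply: (measurableT_comp (f := fine)) => //.
apply: (measurableT_comp (f := fun mu => giry_int mu _)).
  apply: measurable_giry_int.
    by apply/measurable_EFinP; exact: measurable_shift.
  by move=> y; rewrite lee_fin; exact: shift_ge0.
exact: measurable_path_law.
Qed.

(** Chapman-Kolmogorov. The Markov property for the sure event says that the law at time [s] bound
    with the kernel of time [t] is the law at time [s + t]; integrating [shift M f] against both
    measures gives the claim, and the shift cancels because constants are invariant. *)
Lemma markov_op_comp s t f M x : S x -> 0 <= s -> 0 <= t ->
  measurable_fun S f -> (forall y, S y -> `|f y| <= M) ->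
  markov_op X (s + t) f x = markov_op X s (markov_op X t f) x.
Proof.
move=> Sx s0 t0 mf fM.
have st0 : 0 <= s + t by exact: addr_ge0.
pose g := shift M f.
have mg : measurable_fun setT g by exact: measurable_shift.
have g0 y : 0 <= g y by exact: shift_ge0.
have mgS : measurable_fun S g by exact: measurable_funTS.
have gM y : S y -> `|g y| <= M + M by move=> Sy; exact: shift_le.
suff : markov_op X (s + t) g x = markov_op X s (markov_op X t g) x.
  rewrite /g markov_op_shift//.
  rewrite (eq_markov_op (f := markov_op X t _) (g := fun y => markov_op X t f y + M)) //.
    rewrite (markov_opD (M := M) (N := `|M|) (g := cst M))//.
    - by rewrite markov_op_cst => /addIr.
    - exact: measurable_markov_op fM.
    - by move=> y _; exact: ler_norm_markov_op.
  by move=> y _; exact: markov_op_shift.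
have mK : measurable_fun setT (fun w => path_law t0 (mp_path X s w)).
  apply: (measurable_comp (F := S)) => //.
  - by move=> _ [w _ <-]; exact: mp_state.
  - exact: measurable_path_law.
  - exact: mp_measurable.
have E1 : giry_int (giry_bind (mp_law X x : giry _ R) mK) (EFin \o g) =
          giry_int (path_law st0 x) (EFin \o g).
  apply: eq_measure_integral => A mA _.
  rewrite /giry_bind /= /giry_join /=.
  transitivity (giry_int (mp_law X x : giry _ R)
     (fun w => giry_ev (path_law t0 (mp_path X s w)) A)).
    rewrite giry_int_map//.
    exact: measurable_giry_ev.
  have := @mp_markov _ _ _ _ X x s t setT A Sx s0 t0.
  move=> /(_ _ mA); rewrite setTI => H; apply/esym/H.
  (* The sure event belongs to the past of time [s], as the preimage of [setT] at time 0. *)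
  by apply: sub_sigma_algebra; exists 0, setT; rewrite lexx s0 preimage_setT.
have := giry_int_bind (mp_law X x : giry _ R) mK (h := EFin \o g).
rewrite E1 path_law_int// => E2.
rewrite {1}/markov_op E2; last 2 first.
- exact/measurable_EFinP.
- by move=> y; rewrite lee_fin.
rewrite /markov_op unlock; congr fine.
apply: eq_integral => w _.
rewrite path_law_int// (expectation_comp_path (M := M + M))//.
by rewrite /markov_op unlock.
Qed.

End Semigroup.

(** * Comparison of a semigroup with a semigroup of substochastic matrices *)

Section Intertwining.
Context {R : realType} {d : measure_display} {T : measurableType d}.
Context {S : set T} {X : markov_process R S}.
Hypothesis mS : measurable S.

Lemma ler_norm_lincomb (I : Type) (r : seq I) (c : I -> R) (f : I -> T -> R)
    (M : R) y : (forall i, `|f i y| <= M) ->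
  `|\sum_(i <- r) c i * f i y| <= (\sum_(i <- r) `|c i|) * M.
Proof.
move=> fM; rewrite mulr_suml; apply: (le_trans (ler_norm_sum _ _ _)).
by apply: ler_sum => i _; rewrite normrM ler_wpM2l.
Qed.

Lemma measurable_lincomb (I : Type) (r : seq I) (c : I -> R)
    (f : I -> T -> R) : (forall i, measurable_fun S (f i)) ->
  measurable_fun S (fun y => \sum_(i <- r) c i * f i y).
Proof.
move=> mf; apply: measurable_sum => i.
by apply: measurable_funM => //; exact: measurable_cst.
Qed.

Lemma markov_op_lincomb (I : Type) (r : seq I) (c : I -> R)
    (f : I -> T -> R) (M t : R) x : 0 <= t ->
  (forall i, measurable_fun S (f i)) ->
  (forall i y, S y -> `|f i y| <= M) ->
  markov_op X t (fun y => \sum_(i <- r) c i * f i y) x =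
  \sum_(i <- r) c i * markov_op X t (f i) x.
Proof.
move=> t0 mf fM; elim: r => [|i r IH].
  rewrite big_nil (eq_markov_op (g := cst 0)) ?markov_op_cst// => y _.
  by rewrite big_nil.
rewrite big_cons -IH -(markov_opZ mS _ x t0 (mf i) (fM i)).
rewrite -(markov_opD mS (M := `|c i| * M) (N := (\sum_(i <- r) `|c i|) * M))//.
- by apply: eq_markov_op => // y _; rewrite big_cons.
- by apply: measurable_funM => //; exact: measurable_cst.
- by move=> y Sy; rewrite normrM ler_wpM2l// fM.
- exact: measurable_lincomb.
- by move=> y Sy; apply: ler_norm_lincomb => j; exact: fM.
Qed.

Variables (J : finType) (f : J -> T -> R) (p : R -> J -> J -> R) (M : R).
Hypothesis mf : forall j, measurable_fun S (f j).
Hypothesis fM : forall j y, S y -> `|f j y| <= M.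
Hypothesis p_ge0 : forall t i j, 0 < t -> 0 <= p t i j.
Hypothesis p_le1 : forall t i, 0 < t -> \sum_j p t i j <= 1.
Hypothesis p_comp : forall s t i j, 0 < s -> 0 < t ->
  p (s + t) i j = \sum_k p s i k * p t k j.

(** The failure of intertwining at time [t]. The matrices [p] will be the transition matrices of the
    dual on a finite set of configurations. *)
Let defect t j x := markov_op X t (f j) x - \sum_i p t j i * f i x.

(** Errors add up without amplification. The defect after one more step is the semigroup applied to
    the one-step defect plus a substochastic average of the earlier defects, and both operations
    contract the supremum norm. *)
Let defect_iter (h e : R) : 0 < h ->
  (forall x j, S x -> `|defect h j x| <= e) ->
  forall n x j, S x -> `|defect (n.+1%:R * h) j x| <= n.+1%:R * e.
Proof.
move=> h0 he; elim=> [|n IH] x j Sx; first by rewrite !mul1r he.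
have nh0' : 0 < n.+1%:R * h by rewrite mulr_gt0.
have nh0 := ltW nh0'.
have h0' := ltW h0.
have -> : n.+2%:R * h = n.+1%:R * h + h.
  by rewrite -natr1 mulrDl mul1r.
have -> : defect (n.+1%:R * h + h) j x =
    markov_op X (n.+1%:R * h) (defect h j) x +
    \sum_i p h j i * defect (n.+1%:R * h) i x.
  have mh : measurable_fun S (markov_op X h (f j)).
    exact: (measurable_markov_op mS h0' (mf j) (fM j)).
  have ml := measurable_lincomb (index_enum J) (p h j) mf.
  have Ml y Sy := ler_norm_lincomb (index_enum J) (p h j)
    (fun i => fM i Sy : `|f i y| <= _).
  rewrite {1}/defect (markov_op_comp mS Sx nh0 h0' (mf j) (fM j)).
  under [in RHS]eq_bigr do rewrite /defect mulrBr.
  rewrite sumrB -(markov_op_lincomb _ _ _ nh0 mf fM) addrA; congr (_ - _).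
    rewrite -(markov_opD mS (M := e) (N := (\sum_i `|p h j i|) * M)) //.
    - by apply: eq_markov_op => // y _; rewrite subrK.
    - exact: measurable_funB.
    - by move=> y; exact: he.
  (* The matrix side takes the short step first, whereas the semigroup side takes it last. *)
  rewrite (addrC (_ * h)).
  under eq_bigr do rewrite p_comp// mulr_suml.
  rewrite exchange_big /=; apply: eq_bigr => i _.
  by rewrite mulr_sumr; apply: eq_bigr => k _; rewrite mulrA.
rewrite -[n.+2%:R]natr1 mulrDl mul1r [leRHS]addrC.
apply: (le_trans (ler_normD _ _)); apply: lerD.
  apply: ler_norm_markov_op => //; last by move=> y; exact: he.
  apply: measurable_funB => //.
    exact: (measurable_markov_op mS h0' (mf j) (fM j)).
  exact: measurable_lincomb.
apply: (le_trans (ler_norm_sum _ _ _)).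
have e0 : 0 <= e by apply: le_trans (he x j Sx).
apply: (@le_trans _ _ (\sum_i p h j i * (n.+1%:R * e))).
  apply: ler_sum => i _; rewrite normrM ger0_norm ?p_ge0//.
  by rewrite ler_wpM2l ?p_ge0// IH.
by rewrite -mulr_suml ler_piMl ?p_le1// mulr_ge0.
Qed.

(* Telescoping over [t = n h]: each of the [n] steps costs [o(h)], uniformly. *)
Lemma markov_op_intertwine :
  (forall e : R, 0 < e -> \forall h \near 0^'+, forall x j, S x ->
    `|markov_op X h (f j) x - \sum_i p h j i * f i x| <= e * h) ->
  forall t x j, 0 < t -> S x ->
    markov_op X t (f j) x = \sum_i p t j i * f i x.
Proof.
move=> loc t x j t0 Sx; apply/eqP; rewrite -subr_eq0 -normr_eq0.
rewrite eq_le normr_ge0 andbT; apply/ler_addgt0Pr => e e0; rewrite add0r.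
(* At the rate [e / t], the [n.+1] steps of length [t / n.+1] cost [e] altogether. *)
have [h0 /= h00 H] := loc (e / t) (divr_gt0 e0 t0).
pose n := Num.truncn (t / h0).
have hn0 : 0 < t / n.+1%:R by rewrite divr_gt0.
have hn : t / n.+1%:R < h0.
  rewrite ltr_pdivrMr// mulrC -ltr_pdivrMr//.
  exact: truncnS_gt.
have {}H := H (t / n.+1%:R).
have := defect_iter hn0 (e := e / t * (t / n.+1%:R)) _ n j Sx.
rewrite /defect [n.+1%:R * (t / _)]mulrC divfK//.
have -> : n.+1%:R * (e / t * (t / n.+1%:R)) = e.
  by rewrite [e / t * _]mulrA divfK ?gt_eqF// mulrC divfK.
apply => y i Sy; apply: H => //=.
by rewrite sub0r normrN gtr0_norm.
Qed.

End Intertwining.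

(** * Particle configurations *)

Section Bonds.
Context {L : nat}.
Implicit Types i : 'I_L.-1.

Lemma bond_right_proof i : (i.+1 < L)%N.
Proof. by rewrite -ltn_predRL. Qed.

Definition bond_left i : 'I_L := widen_ord (leq_pred L) i.

Definition bond_right i : 'I_L := Ordinal (bond_right_proof i).

Lemma bond_neq i : bond_right i != bond_left i.
Proof. by rewrite -val_eqE /= gtn_eqF. Qed.

Lemma big_bond (V : Type) (idx : V) (op : Monoid.com_law idx) i
    (F : 'I_L -> V) :
  \big[op/idx]_(j < L) F j =
  op (F (bond_left i)) (op (F (bond_right i))
    (\big[op/idx]_(j < L | (j != bond_left i) && (j != bond_right i)) F j)).
Proof. by rewrite (bigD1 (bond_left i))//= (bigD1 (bond_right i)) ?bond_neq. Qed.

Lemma nth_bond_left (A : Type) (a : A) (x : L.-tuple A) i :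
  nth a x i = tnth x (bond_left i).
Proof. by rewrite (tnth_nth a). Qed.

Lemma nth_bond_right (A : Type) (a : A) (x : L.-tuple A) i :
  nth a x i.+1 = tnth x (bond_right i).
Proof. by rewrite (tnth_nth a). Qed.

Lemma set_bond_left (A : Type) (x : L.-tuple A) i a b :
  tnth (set_bond x i a b) (bond_left i) = a.
Proof. by rewrite tnth_mktuple /= eqxx. Qed.

Lemma set_bond_right (A : Type) (x : L.-tuple A) i a b :
  tnth (set_bond x i a b) (bond_right i) = b.
Proof. by rewrite tnth_mktuple /= gtn_eqF// eqxx. Qed.

Lemma set_bond_other (A : Type) (x : L.-tuple A) i a b j :
  (j != bond_left i) && (j != bond_right i) ->
  tnth (set_bond x i a b) j = tnth x j.
Proof.
rewrite -!val_eqE /= => /andP[/negPf j1 /negPf j2].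
by rewrite tnth_mktuple j1 j2.
Qed.

End Bonds.

Section Particles.
Context {R : realType} {L : nat}.
Implicit Types (y z : L.-tuple nat) (N : nat).

Definition total y : nat := \sum_(i < L) tnth y i.

Lemma total_set_bond y (i : 'I_L.-1) r :
  (r <= nth 0%N y i + nth 0%N y i.+1)%N ->
  total (set_bond y i r (nth 0%N y i + nth 0%N y i.+1 - r)%N) = total y.
Proof.
move=> rn; rewrite /total (big_bond _ i) [RHS](big_bond _ i) /=.
rewrite set_bond_left set_bond_right !addnA subnKC//.
rewrite nth_bond_left nth_bond_right; congr (_ + _)%N.
by apply: eq_bigr => j ji; rewrite set_bond_other.
Qed.

(** The space is countable and its points are measurable, as finite intersections of coordinate
    conditions. *)
Lemma measurable_tuple_nat (A : set (L.-tuple nat)) : measurable A.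
Proof.
apply: countable_measurable; last exact: countableP.
move=> y; have -> : [set y] = \bigcap_(i in [set: 'I_L])
    [set z : L.-tuple nat | tnth z i = tnth y i].
  apply/seteqP; split => z; first by move=> ->.
  by move=> zy; apply: eq_from_tnth => i; exact: zy.
apply: fin_bigcap_measurable => [|i _]; first exact: finite_finset.
rewrite -[X in measurable X]setTI.
exact: (measurable_tnth i measurableT (Y := [set tnth y i])).
Qed.

Lemma measurable_fun_tuple_nat d (T : measurableType d)
    (D : set (L.-tuple nat)) (f : L.-tuple nat -> T) : measurable_fun D f.
Proof. by move=> _ B _; exact: measurable_tuple_nat. Qed.

(** No coordinate of a configuration of [N] particles exceeds [N], so filtering the tuples over
    ['I_N.+1] finds them all. *)
Definition shell N : seq (L.-tuple nat) :=
  [seq y <- [seq [tuple (tnth u i : nat) | i < L] | u : L.-tuple 'I_N.+1] |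
     total y == N].

Lemma mem_shell N y : (y \in shell N) = (total y == N).
Proof.
rewrite mem_filter; case: eqP => //= yN.
have yi i : (tnth y i < N.+1)%N.
  by rewrite ltnS -yN /total (bigD1 i)//= leq_addr.
apply/mapP; exists [tuple Ordinal (yi i) | i < L]; first by rewrite mem_enum.
by apply: eq_from_tnth => i; rewrite !tnth_mktuple.
Qed.

Definition shell_type N : finType := seq_sub (shell N).

Definition shell_val N (j : shell_type N) : L.-tuple nat := ssval j.

Lemma total_shell_val N (j : shell_type N) : total (shell_val j) = N.
Proof. by apply/eqP; rewrite -mem_shell; exact: ssvalP. Qed.

Lemma shell_valP N y : total y = N -> exists j : shell_type N, shell_val j = y.
Proof.
move=> yN; have ys : y \in shell N by rewrite mem_shell yN.
by exists (SeqSub ys).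
Qed.

Lemma sum_shell_delta N (g : L.-tuple nat -> R) y : total y = N ->
  \sum_(j : shell_type N) g (shell_val j) * (y == shell_val j)%:R = g y.
Proof.
move=> /shell_valP[j <-]; rewrite (bigD1 j)//= eqxx mulr1 big1 ?addr0//.
move=> i ij; rewrite (_ : _ == _ = false) ?mulr0//.
by apply/negbTE; rewrite eq_sym; exact: ij.
Qed.

(** The generator only looks at configurations with the same total, where [f] is a combination of
    indicators of points: on a shell it is a matrix. *)
Lemma particle_generator_shell nu N (f : L.-tuple nat -> R) y :
  total y = N ->
  particle_generator nu f y = \sum_(j : shell_type N)
    f (shell_val j) *
    particle_generator nu (fun z => (z == shell_val j)%:R) y.
Proof.
move=> yN; rewrite /particle_generator.
under [RHS]eq_bigr do rewrite mulr_sumr.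
rewrite exchange_big /=; apply: eq_bigr => i _.
under [RHS]eq_bigr do rewrite mulr_sumr.
rewrite exchange_big /=; apply: eq_bigr => r _.
under eq_bigr do rewrite mulrA mulrBr.
rewrite -mulr_suml sumrB !sum_shell_delta//.
by rewrite total_set_bond// -ltnS.
Qed.

(** A function of the total passes through the generator. For [f = 1] this makes the indicator of a
    shell harmonic; for a duality function it permits a cut-off to a shell. *)
Lemma particle_generator_conserved nu N (f : L.-tuple nat -> R) y :
  particle_generator nu (fun z => (total z == N)%:R * f z) y =
  (total y == N)%:R * particle_generator nu f y.
Proof.
rewrite /particle_generator mulr_sumr; apply: eq_bigr => i _.
rewrite mulr_sumr; apply: eq_bigr => r _.
by rewrite total_set_bond ?mulrA ?mulrBr // -ltnS.
Qed.

End Particles.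

(** * Particle processes *)

Section GeneratorStep.
Context {R : realType} {d : measure_display} {T : measurableType d}.
Context {S : set T} {X : markov_process R S} {G : (T -> R) -> T -> R}.
Hypothesis GX : has_bounded_generator X G.

(** The generator as a first-order expansion with a uniform error [e * h], the form that can be
    summed along small time steps. *)
Lemma generator_step (f : T -> R) : measurable_fun S f ->
  (exists M : R, forall x, S x -> `|f x| <= M) ->
  forall e : R, 0 < e -> \forall h \near (0 : R)^'+, forall x, S x ->
    `|markov_op X h f x - f x - h * G f x| <= e * h.
Proof.
move=> mf fM e e0; near=> h => x Sx.
have h0 : 0 < h by near: h; exact: nbhs_right_gt.
have : `|(markov_op X h f x - f x) / h - G f x| <= e.
  move: x Sx; near: h; exact: GX.
rewrite -ler_pdivrMr// -(gtr0_norm h0) -normf_div (gtr0_norm h0).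
by rewrite [(_ - h * _) / h]mulrBl [h * _ / h]mulrAC divff ?mul1r// gt_eqF.
Unshelve. all: by end_near. Qed.

End GeneratorStep.

Section ParticleProcess.
Context {R : realType} {L : nat} {nu : nat -> nat -> R}.
Context {Y : markov_process R [set: L.-tuple nat]}.
Hypothesis GY : has_bounded_generator Y (particle_generator nu).
Implicit Types (y : L.-tuple nat) (N : nat) (g : L.-tuple nat -> R).

Let mall D g : measurable_fun D g.
Proof. exact: measurable_fun_tuple_nat. Qed.

Lemma indicator_le1 (b : bool) : `|b%:R| <= 1 :> R.
Proof. by case: b; rewrite ?normr1// normr0. Qed.

(** The intertwining with a single index and the matrix 1: the generator kills the indicator of a
    shell, so the semigroup fixes it. *)
Lemma markov_op_total N t y : 0 < t ->
  markov_op Y t (fun z => (total z == N)%:R) y = (total y == N)%:R.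
Proof.
move=> t0.
rewrite (@markov_op_intertwine _ _ _ _ Y measurableT unit
  (fun=> fun z => (total z == N)%:R) (fun _ _ _ => 1) 1 _ _ _ _ _ _ t y tt)//.
- by rewrite big_const card_unit /= ?addr0 mul1r.
- by move=> _ z _; exact: indicator_le1.
- by move=> s _ _; rewrite big_const card_unit /= ?addr0.
- by move=> r s _ _ _ _; rewrite big_const card_unit /= ?addr0 mulr1.
move=> e e0; pose f (z : L.-tuple nat) : R := (total z == N)%:R.
have fM : exists M, forall z, setT z -> `|f z| <= M.
  by exists 1 => z _; exact: indicator_le1.
apply: filterS (generator_step GY (@mall setT f) fM e0) => h H z _ _.
rewrite big_const card_unit /= ?addr0 mul1r.
have Gf : particle_generator nu f z = 0.
  have := particle_generator_conserved nu N (cst (1 : R)) z.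
  under [in X in X = _ -> _]eq_fun do rewrite mulr1.
  move=> ->; rewrite /particle_generator big1 ?mulr0// => i _.
  by rewrite big1// => r _; rewrite subrr mul0r.
by have := H z Logic.I; rewrite Gf mulr0 subr0.
Qed.

Lemma ae_total_path y t : 0 < t ->
  {ae mp_law Y y, forall w, total (mp_path Y t w) = total y}.
Proof.
move=> t0.
have mA : measurable [set w | total (mp_path Y t w) = total y].
  have := mp_measurable (m := Y) (ltW t0) measurableT
    (measurable_tuple_nat [set z | total z = total y]).
  by rewrite setTI.
exists (~` [set w | total (mp_path Y t w) = total y]); split => //.
  exact: measurableC.
apply: (etrans (probability_setC (mp_law Y y) mA)).
have := markov_op_total (total y) y t0; rewrite eqxx markov_opE.
have E : (fun w => (total (mp_path Y t w) == total y)%:R : R) =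
    \1_[set w | total (mp_path Y t w) = total y].
  apply/funext => w; rewrite indicE.
  by case: eqP => wN; [rewrite mem_set|rewrite memNset].
rewrite E /Rintegral integral_indic// setIT => PA.
have {}PA := congr1 EFin PA; rewrite fineK ?fin_num_measure// in PA.
apply: (etrans (congr1 (fun u => 1 - u)%E PA)).
by rewrite subee.
Qed.

Definition transition t y z : R := markov_op Y t (fun u => (u == z)%:R) y.

(** The path almost surely stays in the finite shell of its starting point, where [g] agrees with
    the bounded function [g']. Integrability therefore holds for an arbitrary [g]. *)
Lemma expectation_shell N t y g : total y = N -> 0 < t ->
  (mp_law Y y).-integrable setT (fun w => (g (mp_path Y t w))%:E) /\
  ('E_(mp_law Y y)[fun w => g (mp_path Y t w)])%E =
    (\sum_(j : shell_type N) transition t y (shell_val j) * g (shell_val j))%:E.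
Proof.
move=> yN t0; have t0' := ltW t0.
pose g' (u : L.-tuple nat) : R :=
  \sum_(j : shell_type N) g (shell_val j) * (u == shell_val j)%:R.
have mY (h : L.-tuple nat -> R) : measurable_fun setT (fun w => (h (mp_path Y t w))%:E).
  by apply/measurable_EFinP; exact: measurable_comp_path.
have gg' : ae_eq (mp_law Y y) setT (fun w => (g (mp_path Y t w))%:E)
    (fun w => (g' (mp_path Y t w))%:E).
  apply: filterS (ae_total_path y t0) => w wN _.
  by rewrite /g' sum_shell_delta// wN.
have g'M u : [set: L.-tuple nat] u ->
    `|g' u| <= (\sum_(j : shell_type N) `|g (shell_val j)|) * 1.
  move=> _; apply: (@ler_norm_lincomb _ _ _ _ (index_enum (shell_type N))
    (fun j => g (shell_val j)) (fun j u => (u == shell_val j)%:R)) => j.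
  exact: indicator_le1.
have ig' : (mp_law Y y).-integrable setT (fun w => (g' (mp_path Y t w))%:E).
  have := integrable_comp_path (X := Y) measurableT y t0' (@mall setT g') g'M.
  exact.
split.
  apply/integrableP; split => //.
  rewrite (ae_eq_integral (fun w => `|(g' (mp_path Y t w))%:E|)%E)//.
  - by move/integrableP : ig' => [].
  - by apply: measurableT_comp => //; exact: mY.
  - by apply: measurableT_comp => //; exact: mY.
  - by apply: filterS gg' => w + _ => ->.
rewrite unlock (ae_eq_integral _ _ measurableT (mY g) (mY g') gg')//.
have := expectation_comp_path (X := Y) measurableT y t0' (@mall setT g') g'M.
rewrite unlock => ->.
rewrite /g' (markov_op_lincomb measurableT _ _ _ t0' _ (M := 1))//.
- by congr EFin; apply: eq_bigr => j _; rewrite mulrC.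
- by move=> j z _; exact: indicator_le1.
Qed.

Lemma markov_op_shell N t y g : total y = N -> 0 < t ->
  markov_op Y t g y =
    \sum_(j : shell_type N) transition t y (shell_val j) * g (shell_val j).
Proof.
by move=> yN t0; rewrite /markov_op (expectation_shell g yN t0).2.
Qed.

Lemma transition_ge0 t y z : 0 <= transition t y z.
Proof. by rewrite /transition markov_opE; apply: Rintegral_ge0. Qed.

Lemma sum_transition N t y : 0 < t -> total y = N ->
  \sum_(j : shell_type N) transition t y (shell_val j) = 1.
Proof.
move=> t0 yN; rewrite -[RHS](markov_op_cst (X := Y) t 1 y) (markov_op_shell _ yN t0).
by apply: eq_bigr => j _; rewrite mulr1.
Qed.

Lemma transition_comp N s t y z : 0 < s -> 0 < t -> total y = N ->
  transition (s + t) y z =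
  \sum_(k : shell_type N) transition s y (shell_val k) * transition t (shell_val k) z.
Proof.
move=> s0 t0 yN; rewrite {1}/transition.
rewrite (markov_op_comp (M := 1) measurableT _ (ltW s0) (ltW t0))//.
- by rewrite (markov_op_shell _ yN s0).
- by move=> u _; exact: indicator_le1.
Qed.

End ParticleProcess.

(** * Duality of processes from duality of generators *)

Section GeneratorDuality.
Context {R : realType} {d : measure_display} {T : measurableType d} {L : nat}.
Context {S : set T} {X : markov_process R S} {G : (T -> R) -> T -> R}.
Context {Y : markov_process R [set: L.-tuple nat]} {nu : nat -> nat -> R}.
Hypothesis mS : measurable S.
Hypothesis GX : has_bounded_generator X G.
Hypothesis GY : has_bounded_generator Y (particle_generator nu).

(** The transition matrix of [Y] on the shell takes the place of [p] in [markov_op_intertwine]. What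
    is left is a one-step estimate: expand [D] under [X] and each point indicator under [Y] to first
    order, and the terms of order 0 and 1 agree by the duality of the generators. *)
Lemma generator_duality (N : nat) (D : T -> L.-tuple nat -> R) x y (t : R) :
  (forall z, total z = N -> measurable_fun S (D^~ z)) ->
  (forall z, total z = N -> exists M : R, forall x, S x -> `|D x z| <= M) ->
  (forall x z, S x -> total z = N ->
     G (D^~ z) x = particle_generator nu (D x) z) ->
  S x -> total y = N -> 0 < t ->
  markov_op X t (D^~ y) x = markov_op Y t (D x) y.
Proof.
move=> mD DM GD Sx yN t0.
pose J := shell_type (L := L) N.
have [M0 M0P] : {M0 : J -> R & forall j x, S x -> `|D x (shell_val j)| <= M0 j}.
  by apply: (choice (fun j => DM _ (total_shell_val j))).
pose M : R := \sum_j `|M0 j|.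
have DM' (j : J) z : S z -> `|D z (shell_val j)| <= M.
  move=> Sz; apply: (le_trans (M0P j z Sz)); apply: (le_trans (ler_norm _)).
  by rewrite /M (bigD1 j)//= lerDl sumr_ge0.
have M_ge0 : 0 <= M by exact: sumr_ge0.
pose delta (j : J) (z : L.-tuple nat) : R := (z == shell_val j)%:R.
have [j jy] := shell_valP yN; rewrite -jy.
rewrite (markov_op_shell GY _ (total_shell_val j) t0).
apply: (markov_op_intertwine (X := X) mS (f := fun j z => D z (shell_val j))
   (p := fun t i k => transition (Y := Y) t (shell_val i) (shell_val k)) (M := M)) => //.
- by move=> i; apply: mD; exact: total_shell_val.
- by move=> s i k _; exact: transition_ge0.
- by move=> s i s0; rewrite (sum_transition GY s0)//; exact: total_shell_val.
- move=> r s i k r0 s0.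
  by rewrite (transition_comp GY _ r0 s0 (total_shell_val i)).
move=> e e0.
(* The dual side contributes [#|J|] errors of size at most [M * (e' * h)], in total at most
   [e / 2 * h]; the added 1 keeps the denominator positive. *)
pose e' := e / (2 * (M *+ #|J| + 1)).
have K0 : 0 < M *+ #|J| + 1 by rewrite ltr_wpDl// mulrn_wge0.
have e'0 : 0 < e' by rewrite divr_gt0// mulr_gt0.
have HX : \forall h \near 0^'+, forall (i : J) z, S z ->
   `|markov_op X h (D^~ (shell_val i)) z - D z (shell_val i) -
     h * G (D^~ (shell_val i)) z| <= (e / 2) * h.
  apply: filter_forall => i; apply: (generator_step GX); last exact: divr_gt0.
    by apply: mD; exact: total_shell_val.
  by apply: DM; exact: total_shell_val.
have HY : \forall h \near 0^'+, forall (i : J) z,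
   `|markov_op Y h (delta i) z - delta i z -
     h * particle_generator nu (delta i) z| <= e' * h.
  apply: filter_forall => i.
  have dM : exists M1, forall z, [set: L.-tuple nat] z -> `|delta i z| <= M1.
    by exists 1 => z _; exact: indicator_le1.
  have md : measurable_fun [set: L.-tuple nat] (delta i).
    exact: measurable_fun_tuple_nat.
  by apply: filterS (generator_step GY md dM e'0) => h H z; exact: H.
near=> h => z i Sz.
have h0 : 0 < h by near: h; exact: nbhs_right_gt.
have HX1 : `|markov_op X h (D^~ (shell_val i)) z - D z (shell_val i) -
     h * G (D^~ (shell_val i)) z| <= (e / 2) * h.
  by move: i z Sz; near: h; exact: HX.
have HY1 (k : J) : `|markov_op Y h (delta k) (shell_val i) - delta k (shell_val i) -
     h * particle_generator nu (delta k) (shell_val i)| <= e' * h.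
  by move: (shell_val i); move: k; near: h; exact: HY.
rewrite GD ?total_shell_val// in HX1.
rewrite (particle_generator_shell nu _ (total_shell_val i)) in HX1.
rewrite -(sum_shell_delta (D z) (total_shell_val i)) in HX1.
set A := markov_op X h _ z in HX1 *.
set s1 := \sum_j _ in HX1; set s2 := \sum_j _ in HX1.
(* [s3] collects the errors of the indicators; the rest of the dual expansion is [s1 + h * s2],
   exactly as for [X]. *)
pose s3 := \sum_(k : J) D z (shell_val k) * (markov_op Y h (delta k) (shell_val i) -
      delta k (shell_val i) - h * particle_generator nu (delta k) (shell_val i)).
have -> : \sum_(k : J) transition (Y := Y) h (shell_val i) (shell_val k) *
    D z (shell_val k) = s1 + h * s2 + s3.
  rewrite mulr_sumr -!big_split /=; apply: eq_bigr => k _.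
  by rewrite /transition -/(delta k) -/(delta k (shell_val i)); ring.
rewrite !opprD !addrA.
apply: (le_trans (ler_normB _ _)).
have -> : e * h = e / 2 * h + e / 2 * h by field.
apply: lerD; first exact: HX1.
apply: (le_trans (ler_norm_sum _ _ _)).
apply: (@le_trans _ _ (\sum_(k : J) M * (e' * h))).
  apply: ler_sum => k _; rewrite normrM ler_pM//.
  exact: DM'.
rewrite sumr_const -mulrnAl mulrA ler_wpM2r ?(ltW h0)//.
have -> : e' = e / 2 / (M *+ #|J| + 1) by rewrite /e' invfM mulrA.
by rewrite mulrCA ger_pMr ?divr_gt0// ler_pdivrMr// mul1r lerDl.
Unshelve. all: by end_near. Qed.

End GeneratorDuality.

(** * The ASIP duality *)

Section QCalculus.
Context {R : realType}.
Variable q : R.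
Hypotheses (q0 : 0 < q) (q1 : q < 1).
Implicit Types (a b c k : R) (m n r s : nat).

Lemma qexpD a b : q `^ (a + b) = q `^ a * q `^ b.
Proof. by rewrite powRD// (gt_eqF q0) implybT. Qed.

Lemma qexp_neq0 a : q `^ a != 0.
Proof. by rewrite gt_eqF// powR_gt0. Qed.

Lemma qnum0 : qnum q 0 = 0.
Proof. by rewrite /qnum oppr0 subrr mul0r. Qed.

Lemma qnumN a : qnum q (- a) = - qnum q a.
Proof. by rewrite /qnum opprK -opprB mulNr. Qed.

Lemma qnumD a b : qnum q (a + b) = q `^ (- b) * qnum q a + q `^ a * qnum q b.
Proof. rewrite /qnum opprD !qexpD; ring. Qed.

Lemma qnum_gt0 a : 0 < a -> 0 < qnum q a.
Proof.
move=> a0.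
have -> : qnum q a = (q `^ (- a) - q `^ a) / (q^-1 - q).
  by rewrite /qnum -opprB -[q - _]opprB invrN mulrNN.
have qa1 : q `^ a < 1.
  have <- : 1 `^ a = 1 :> R by rewrite powR1.
  by rewrite gt0_ltr_powR// nnegrE ltW.
rewrite divr_gt0// subr_gt0; last by rewrite (lt_trans q1)// invf_gt1.
by rewrite (lt_trans qa1)// powRN invf_gt1// powR_gt0.
Qed.

Lemma qnumS_neq0 n : qnum q n.+1%:R != 0.
Proof. by rewrite gt_eqF// qnum_gt0. Qed.

(** The q-binomial coefficient of [a + n - 1] over [n] for real [a]. Positive [a] gives the ASIP
    weights, and negative integers give the q-binomials of the duality function up to sign. *)
Definition qrise a n : R :=
  \prod_(m < n) (qnum q (a + m%:R) / qnum q m.+1%:R).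

Lemma qrise0 a : qrise a 0 = 1.
Proof. by rewrite /qrise big_ord0. Qed.

Lemma qriseS a n :
  qnum q n.+1%:R * qrise a n.+1 = qnum q (a + n%:R) * qrise a n.
Proof.
rewrite /qrise big_ord_recr /= mulrCA [_ * (_ / _)]mulrC.
by rewrite divfK ?qnumS_neq0// mulrC.
Qed.

Lemma qrise_gt0 a n : 0 < a -> 0 < qrise a n.
Proof.
move=> a0; apply: prodr_gt0 => m _.
by rewrite divr_gt0// qnum_gt0// ltr_wpDr.
Qed.

(* Induction through [n+1] = q^-(n+1-r) [r] + q^r [n+1-r]: each of the two terms
   cancels a denominator and gives a summand of rank [n]. *)
Lemma qvandermonde a b n :
  \sum_(r < n.+1) q `^ (- ((a + b) * r%:R)) * qrise a r * qrise b (n - r) =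
  q `^ (- (a * n%:R)) * qrise (a + b) n.
Proof.
elim: n => [|n IH].
  by rewrite big_ord1 !mulr0 oppr0 powRr0 !qrise0 !mulr1.
apply: (mulfI (qnumS_neq0 n)).
rewrite [RHS]mulrCA qriseS -[in RHS]natr1 mulrDr mulr1 opprD qexpD.
have -> : q `^ (- (a * n%:R)) * q `^ (- a) * (qnum q (a + b + n%:R) * qrise (a + b) n)
  = q `^ (- a) * qnum q (a + b + n%:R) * (q `^ (- (a * n%:R)) * qrise (a + b) n) by ring.
rewrite -IH mulr_sumr [RHS]mulr_sumr.
pose w r : R := q `^ (- ((a + b) * r%:R)).
have split_r (r : 'I_n.+2) : qnum q n.+1%:R *
    (w r * qrise a r * qrise b (n.+1 - r)) =
  q `^ (- (n.+1 - r)%:R) * w r * (qnum q r%:R * qrise a r) * qrise b (n.+1 - r) +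
  q `^ r%:R * w r * qrise a r * (qnum q (n.+1 - r)%:R * qrise b (n.+1 - r)).
  have rn : (r <= n.+1)%N by rewrite -ltnS.
  rewrite -{1}(subnKC rn) natrD qnumD; ring.
rewrite (eq_bigr _ (fun (r : 'I_n.+2) _ => split_r r)) big_split /=.
(* Since [0] = 0, the first term of one sum and the last term of the other vanish, and both sums
   have [n.+1] terms left. *)
rewrite big_ord_recl /= qnum0 mul0r mulr0 mul0r add0r.
rewrite [X in _ + X]big_ord_recr /= subnn qnum0 mul0r mulr0 addr0.
rewrite -big_split /=; apply: eq_bigr => r _.
have rn : (r <= n)%N by rewrite -ltnS.
rewrite /bump /= add1n subSS qriseS subSn// qriseS.
have -> : w r.+1 = w r * q `^ (- (a + b)).
  by rewrite /w -qexpD; congr (_ `^ _); rewrite -natr1; ring.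
(* On the right the same addition rule splits [a + b + n], after which the two sides agree term by
   term. *)
have -> : a + b + n%:R = (a + r%:R) + (b + (n - r)%:R).
  by rewrite natrB//; ring.
rewrite (qnumD (a + r%:R)) -/(w r) !opprD !qexpD.
have -> : q `^ (- a) * (q `^ (- b) * q `^ (- (n - r)%:R) * qnum q (a + r%:R) +
    q `^ a * q `^ r%:R * qnum q (b + (n - r)%:R)) *
    (w r * qrise a r * qrise b (n - r)) =
  q `^ (- a) * q `^ (- b) * q `^ (- (n - r)%:R) * qnum q (a + r%:R) *
    (w r * qrise a r * qrise b (n - r)) +
  (q `^ (- a) * q `^ a) * q `^ r%:R * qnum q (b + (n - r)%:R) *
    (w r * qrise a r * qrise b (n - r)) by ring.
rewrite -[q `^ (- a) * q `^ a]qexpD addNr powRr0; ring.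
Qed.

Lemma qfactS n : qfact q n.+1 = qfact q n * qnum q n.+1%:R.
Proof. by rewrite /qfact big_nat_recr. Qed.

Lemma qfact0 : qfact q 0 = 1.
Proof. by rewrite /qfact big_geq. Qed.

Lemma qfact_neq0 n : qfact q n != 0.
Proof.
elim: n => [|n IH]; first by rewrite qfact0 oner_neq0.
by rewrite qfactS mulf_neq0// qnumS_neq0.
Qed.

Lemma qbinom2kE k n : qbinom2k q k n = qrise (2 * k) n.
Proof.
rewrite /qbinom2k big_add1 /= big_mkord; apply: eq_bigr => m _.
by congr (qnum q _ / _); rewrite -natr1; ring.
Qed.

Lemma qrise_fact a n : qrise a n * qfact q n = \prod_(m < n) qnum q (a + m%:R).
Proof.
elim: n => [|n IH]; first by rewrite qrise0 qfact0 big_ord0 mulr1.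
rewrite qfactS big_ord_recr /= -IH [RHS]mulrAC [qrise _ _ * qnum _ _]mulrC.
by rewrite -qriseS; ring.
Qed.

(** The q-analogue of the splitting of a Pochhammer symbol of length [m + n] at [m]. It lets a
    q-binomial of the duality function be absorbed into a weight by raising its parameter. *)
Lemma qrise_split a m n : 0 < a ->
  qrise a (m + n) * qbinom q (m + n) m = qrise a m * qrise (a + m%:R) n.
Proof.
move=> a0; rewrite /qbinom mulrA qrise_fact addKn.
rewrite -[LHS](mulfK (mulf_neq0 (qfact_neq0 m) (qfact_neq0 n))).
apply: (canLR (mulfK _)); first by rewrite mulf_neq0 ?qfact_neq0.
rewrite divfK ?mulf_neq0 ?qfact_neq0//.
rewrite big_split_ord /= mulrACA !qrise_fact; congr (_ * _).
by apply: eq_bigr => i _; rewrite natrD addrA.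
Qed.

(** Each numerator [j - n] is -[n - j], which gives the falling product of the q-binomial; for
    [m > n] the product contains [0], in agreement with the indicator. *)
Lemma qrise_opp n m : (-1) ^+ m * qrise (- n%:R) m = qbinom q n m * (m <= n)%N%:R.
Proof.
have [mn|nm] := leqP m n; last first.
  rewrite mulr0 /qrise (bigD1 (Ordinal nm))//= addNr qnum0 !mul0r mulr0 //.
rewrite mulr1; elim: m mn => [|m IH] mn.
  by rewrite qrise0 /qbinom subn0 qfact0 mul1r divff ?mulr1// qfact_neq0.
apply: (mulfI (qnumS_neq0 m)).
rewrite mulrCA qriseS exprS -mulrA [_ ^+ m * _]mulrCA IH ?(ltnW mn)//.
rewrite mulrA mulN1r -qnumN.
rewrite opprD opprK -natrB ?(ltnW mn)// /qbinom qfactS.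
rewrite -(subnSK mn) qfactS; field.
by rewrite !qfact_neq0 !qnumS_neq0.
Qed.

End QCalculus.

(** * The two-site identities for ASIP *)

Section AsipTwoSite.
Context {R : realType}.
Variables q k : R.
Hypotheses (q0 : 0 < q) (q1 : q < 1) (k0 : 0 < k).
Implicit Types (c : R) (i m n r s : nat).

Let k2_gt0 : 0 < 2 * k. Proof. by rewrite mulr_gt0. Qed.

Let rise2_neq0 n : qrise q (2 * k) n != 0.
Proof. by rewrite gt_eqF// qrise_gt0. Qed.

(** The q-Vandermonde convolution with both parameters equal to [2 * k]. *)
Lemma asip_partition m : \sum_(s < m.+1) nu_ASIP_weight q k s m =
  q `^ (- (2 * k * m%:R)) * qrise q (4 * k) m.
Proof.
have -> : 4 * k = 2 * k + 2 * k by ring.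
rewrite -qvandermonde//; apply: eq_bigr => s _.
by rewrite /nu_ASIP_weight !qbinom2kE; congr (_ `^ _ * _ * _); ring.
Qed.

Lemma asip_partition_neq0 m : \sum_(s < m.+1) nu_ASIP_weight q k s m != 0.
Proof.
by rewrite asip_partition mulf_neq0 ?qexp_neq0// gt_eqF// qrise_gt0// mulr_gt0.
Qed.

Lemma sum_nu_ASIP n : \sum_(r < n.+1) nu_ASIP q k r n = 1.
Proof. by rewrite /nu_ASIP -mulr_suml divff// asip_partition_neq0. Qed.

(** The factor of [D_ASIP] at position [i]. The argument [c] stands for the number of dual particles
    to the left, so that a pair of neighbours can be studied in isolation. *)
Definition asip_site i c n m : R :=
  qbinom q n m / qbinom2k q k m *
  q `^ ((n%:R - m%:R) * (2 * c + m%:R) - 4 * k * i.+1%:R * m%:R) *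
  (m <= n)%N%:R.

(* The junk value of [qbinom q n m] for [n < m] disappears in this form, since
   [qrise q (- n) m] has then a zero factor. *)
Lemma asip_siteE i c n m : asip_site i c n m =
  (-1) ^+ m * qrise q (- n%:R) m / qrise q (2 * k) m *
  q `^ ((n%:R - m%:R) * (2 * c + m%:R) - 4 * k * i.+1%:R * m%:R).
Proof. by rewrite qrise_opp// /asip_site qbinom2kE; ring. Qed.

(** The common value of the two thermalized sides. It depends on the totals of the bond only:
    thermalizing the process forgets how [n] was split, thermalizing the dual how [m] was. *)
Definition asip_two_site i c n m : R :=
  q `^ (2 * c * (n%:R - m%:R) - 4 * k * i.+2%:R * m%:R + n%:R * m%:R - m%:R ^+ 2)
  * ((-1) ^+ m * qrise q (- n%:R) m) / \sum_(s < m.+1) nu_ASIP_weight q k s m.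

(** The weights cancel the denominators [qrise q (2 * k)] of the duality function, leaving a
    q-Vandermonde convolution with parameters [- n1] and [- n2]. The second site sees the [s] dual
    particles put on the first. *)
Lemma asip_two_site_dual i c n1 n2 m :
  \sum_(s < m.+1) asip_site i c n1 s * asip_site i.+1 (c + s%:R) n2 (m - s)
    * nu_ASIP q k s m = asip_two_site i c (n1 + n2) m.
Proof.
(* [K] is the part of the exponent of [q] that does not depend on [s]. *)
pose K := 2 * c * (n1%:R + n2%:R - m%:R) - 4 * k * i.+2%:R * m%:R
  + n2%:R * m%:R - m%:R ^+ 2.
pose Z := \sum_(s < m.+1) nu_ASIP_weight q k s m.
have term (s : 'I_m.+1) :
    asip_site i c n1 s * asip_site i.+1 (c + s%:R) n2 (m - s) * nu_ASIP q k s m =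
    q `^ K * (-1) ^+ m / Z *
    (q `^ (- ((- n1%:R + - n2%:R) * s%:R)) * qrise q (- n1%:R) s *
     qrise q (- n2%:R) (m - s)).
  have sm : (s <= m)%N by rewrite -ltnS.
  rewrite !asip_siteE /nu_ASIP -/Z /nu_ASIP_weight !qbinom2kE.
  have -> : (-1) ^+ m = (-1) ^+ s * (-1) ^+ (m - s) :> R.
    by rewrite -exprD subnKC.
  set e1 := q `^ (_ - _); set e2 := q `^ (_ - _); set e3 := q `^ (- (4 * k * _)).
  have E : e1 * e2 * e3 = q `^ K * q `^ (- ((- n1%:R + - n2%:R) * s%:R)).
    rewrite -!qexpD//; congr (_ `^ _); rewrite /K natrB//.
    rewrite -[i.+2%:R]natr1; ring.
  transitivity (e1 * e2 * e3 * ((-1) ^+ s * (-1) ^+ (m - s) / Z *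
      (qrise q (- n1%:R) s * qrise q (- n2%:R) (m - s)))).
    by field; rewrite !rise2_neq0 asip_partition_neq0.
  by rewrite E; ring.
rewrite (eq_bigr _ (fun (s : 'I_m.+1) _ => term s)) -mulr_sumr qvandermonde//.
rewrite /asip_two_site -/Z natrD -opprD.
have -> : q `^ (2 * c * (n1%:R + n2%:R - m%:R) - 4 * k * i.+2%:R * m%:R +
   (n1%:R + n2%:R) * m%:R - m%:R ^+ 2) = q `^ K * q `^ (- (- n1%:R * m%:R)).
  by rewrite -qexpD//; congr (_ `^ _); rewrite /K; ring.
ring.
Qed.

Lemma asip_two_site_gt i c n m : (n < m)%N -> asip_two_site i c n m = 0.
Proof.
by move=> nm; rewrite /asip_two_site qrise_opp// leqNgt nm !(mulr0, mul0r).
Qed.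

(** Used to restrict [r] to the range from [m1] to [n - m2] left by the two indicators. *)
Lemma sum_ord_shift (F : nat -> R) (a b N n : nat) : n = (a + N + b)%N ->
  (forall r, (r < a)%N -> F r = 0) -> (forall r, (a + N < r <= n)%N -> F r = 0) ->
  \sum_(r < n.+1) F r = \sum_(r < N.+1) F (a + r)%N.
Proof.
move=> -> Fa Fb; rewrite -[LHS](big_mkord xpredT).
rewrite (big_cat_nat (n := a))//=; last by lia.
rewrite big_nat_cond big1 ?add0r; last by move=> r /andP[/andP[_ /Fa]].
rewrite (big_cat_nat (n := (a + N).+1))//=; [|by lia|by lia].
rewrite [X in _ + X]big_nat_cond [X in _ + X]big1 ?addr0; last first.
  by move=> r /andP[/andP[ar rn] _]; rewrite Fb// ar -ltnS.
rewrite -{1}[a]add0n big_addn -addnS addKn big_mkord.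
by apply: eq_bigr => r _; rewrite addnC.
Qed.

(** On the range left by the indicators, [qrise_split] absorbs the q-binomials into the weights,
    whose parameters become [2 * k + m1] and [2 * k + m2]. The q-Vandermonde sum has parameter
    [4 * k + m1 + m2], and [qrise_split] read backwards turns it into the q-binomial of the
    totals. *)
Lemma asip_two_site_self i c n m1 m2 :
  \sum_(r < n.+1) asip_site i c r m1 * asip_site i.+1 (c + m1%:R) (n - r) m2
    * nu_ASIP q k r n = asip_two_site i c n (m1 + m2).
Proof.
(* With more dual particles than particles, every term on the left has a false indicator and the
   right side vanishes too. *)
have [nm|mn] := ltnP n (m1 + m2).
  rewrite asip_two_site_gt// big1// => r _; rewrite /asip_site.
  have [m1r|] := leqP m1 r; last by rewrite !(mulr0, mul0r).
  have [m2r|] := leqP m2 (n - r); last by rewrite !(mulr0, mul0r).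
  by have := ltn_ord r; lia.
pose N := (n - (m1 + m2))%N.
have nE : n = (m1 + N + m2)%N by rewrite addnAC subnKC.
pose Z := \sum_(s < n.+1) nu_ASIP_weight q k s n.
have Z0 : Z != 0 by exact: asip_partition_neq0.
rewrite (sum_ord_shift (F := fun r => asip_site i c r m1 *
  asip_site i.+1 (c + m1%:R) (n - r) m2 * nu_ASIP q k r n) nE).
- pose K := 2 * c * N%:R + N%:R * (2 * m1%:R + m2%:R) - 4 * k * i.+2%:R * (m1 + m2)%:R.
  have term (r : 'I_N.+1) : asip_site i c (m1 + r) m1 *
      asip_site i.+1 (c + m1%:R) (n - (m1 + r)) m2 * nu_ASIP q k (m1 + r) n =
      q `^ K / Z * (q `^ (- ((2 * k + m1%:R + (2 * k + m2%:R)) * r%:R)) *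
        qrise q (2 * k + m1%:R) r * qrise q (2 * k + m2%:R) (N - r)).
    have rN : (r <= N)%N by rewrite -ltnS.
    have -> : (n - (m1 + r) = m2 + (N - r))%N.
      by rewrite {1}nE -addnA subnDl addnC -addnBA.
    rewrite /nu_ASIP -/Z /nu_ASIP_weight /asip_site !leq_addr !mulr1 !qbinom2kE.
    have -> : (n - (m1 + r) = m2 + (N - r))%N.
      by rewrite {1}nE -addnA subnDl addnC -addnBA.
    have H1 : (qrise q (2 * k) m1)^-1 * (qrise q (2 * k) (m1 + r) *
        qbinom q (m1 + r) m1) = qrise q (2 * k + m1%:R) r.
      by rewrite qrise_split// mulKf.
    have H2 : (qrise q (2 * k) m2)^-1 * (qrise q (2 * k) (m2 + (N - r)) *
        qbinom q (m2 + (N - r)) m2) = qrise q (2 * k + m2%:R) (N - r).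
      by rewrite qrise_split// mulKf.
    set e1 := q `^ (_ - _); set e2 := q `^ (_ - _); set e3 := q `^ (- (4 * k * _)).
    have E : e1 * e2 * e3 = q `^ K *
        q `^ (- ((2 * k + m1%:R + (2 * k + m2%:R)) * r%:R)).
      rewrite -!qexpD//; congr (_ `^ _); rewrite /K !natrD natrB//.
      rewrite -[i.+2%:R]natr1; ring.
    rewrite -{}H1 -{}H2.
    transitivity (e1 * e2 * e3 * (qrise q (2 * k) (m1 + r) * qbinom q (m1 + r) m1
      * (qrise q (2 * k) (m2 + (N - r)) * qbinom q (m2 + (N - r)) m2)
      / (Z * qrise q (2 * k) m1 * qrise q (2 * k) m2))).
      by field; rewrite !rise2_neq0.
    by rewrite E; field; rewrite !rise2_neq0.
  rewrite (eq_bigr _ (fun (r : 'I_N.+1) _ => term r)) -mulr_sumr qvandermonde//.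
  rewrite /asip_two_site qrise_opp// mn mulr1.
  have H := @qrise_split _ q q0 q1 (4 * k) (m1 + m2) N.
  have nE' : n = (m1 + m2 + N)%N by rewrite /N subnKC.
  rewrite /Z !asip_partition -{}nE' in H *.
  have -> : 2 * k + m1%:R + (2 * k + m2%:R) = 4 * k + (m1 + m2)%:R.
    by rewrite natrD; ring.
  have B0 p : qrise q (4 * k) p != 0 by rewrite gt_eqF// qrise_gt0// mulr_gt0.
  have -> : qrise q (4 * k + (m1 + m2)%:R) N =
      qrise q (4 * k) n * qbinom q n (m1 + m2) / qrise q (4 * k) (m1 + m2).
    by rewrite H ?mulr_gt0// mulrAC mulfV// mul1r.
  set X := q `^ (_ - _ ^+ 2); set em := q `^ (- (2 * k * (m1 + m2)%:R)).
  set en := q `^ (- (2 * k * n%:R)).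
  have em0 : em != 0 by exact: qexp_neq0.
  have en0 : en != 0 by exact: qexp_neq0.
  set eN := q `^ (- (_ * N%:R)).
  have nR : n%:R = m1%:R + N%:R + m2%:R :> R by rewrite -!natrD -nE.
  have E : q `^ K * eN * em = X * en.
    rewrite -!qexpD//; congr (_ `^ _); rewrite /K nR !natrD.
    by rewrite -[i.+2%:R]natr1; ring.
  transitivity (q `^ K * eN * em * qbinom q n (m1 + m2) /
      (en * em * qrise q (4 * k) (m1 + m2))).
    by field; rewrite !B0 em0 en0.
  by rewrite E; field; rewrite !B0 em0 en0.
- move=> r rm; rewrite /asip_site leqNgt rm /=; ring.
- move=> r /andP[rm rn]; rewrite /asip_site [(m2 <= _)%N]leqNgt.
  by rewrite (_ : (n - r < m2)%N) /=; [ring|lia].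
Qed.

End AsipTwoSite.

(** * Duality of the ASIP generator on the lattice *)

Section AsipDuality.
Context {R : realType} {L : nat}.
Variables q k : R.
Hypotheses (q0 : 0 < q) (q1 : q < 1) (k0 : 0 < k).
Implicit Types (eta xi : L.-tuple nat).

Definition left_sum xi j : R := \sum_(m < L | (m < j)%N) (tnth xi m)%:R.

Lemma left_sum_right xi (i : 'I_L.-1) :
  left_sum xi i.+1 = left_sum xi i + (tnth xi (bond_left i))%:R.
Proof.
rewrite /left_sum (bigD1 (bond_left i))//= addrC; congr (_ + _).
by apply: eq_bigl => j; rewrite -val_eqE /= ltnS [RHS]ltn_neqAle andbC.
Qed.

(** An exchange across a bond is seen from the left only between its two sites, that is, at
    [j = i.+1]. *)
Lemma left_sum_set_bond xi (i : 'I_L.-1) s j :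
  (s <= nth 0%N xi i + nth 0%N xi i.+1)%N -> j != i.+1 ->
  left_sum (set_bond xi i s (nth 0%N xi i + nth 0%N xi i.+1 - s)%N) j =
  left_sum xi j.
Proof.
move=> sm ji; rewrite /left_sum big_mkcond (big_bond _ i) [RHS]big_mkcond.
rewrite [RHS](big_bond _ i) /= set_bond_left set_bond_right.
rewrite -!(nth_bond_left 0%N xi) -!(nth_bond_right 0%N xi) !addrA; congr (_ + _).
  have -> : (i.+1 < j)%N = (i < j)%N by rewrite ltn_neqAle eq_sym ji.
  by case: ifP => //; rewrite -!natrD subnKC.
by apply: eq_bigr => l li; rewrite set_bond_other.
Qed.

Lemma D_ASIPE eta xi (i : 'I_L.-1) : D_ASIP q k eta xi =
  asip_site q k i (left_sum xi i) (tnth eta (bond_left i)) (tnth xi (bond_left i)) *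
  asip_site q k i.+1 (left_sum xi i + (tnth xi (bond_left i))%:R)
    (tnth eta (bond_right i)) (tnth xi (bond_right i)) *
  \prod_(j < L | (j != bond_left i) && (j != bond_right i))
    asip_site q k j (left_sum xi j) (tnth eta j) (tnth xi j).
Proof. by rewrite -left_sum_right -mulrA -[RHS]big_bond. Qed.

(** The rates of a bond sum to 1, so its term is a thermalized value minus [D_ASIP]. The factors
    away from the bond come out as [rest], and both thermalized values equal [asip_two_site] times
    [rest]. *)
Lemma asip_generator_dual eta xi :
  particle_generator (nu_ASIP q k) (D_ASIP q k ^~ xi) eta =
  particle_generator (nu_ASIP q k) (D_ASIP q k eta) xi.
Proof.
apply: eq_bigr => i _ /=.
set n := (nth 0%N eta i + _)%N; set m := (nth 0%N xi i + _)%N.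
under eq_bigr do rewrite mulrBl.
under [RHS]eq_bigr do rewrite mulrBl.
rewrite !sumrB -!mulr_sumr !sum_nu_ASIP// !mulr1; congr (_ - _).
pose rest := \prod_(j < L | (j != bond_left i) && (j != bond_right i))
    asip_site q k j (left_sum xi j) (tnth eta j) (tnth xi j).
transitivity (asip_two_site q k i (left_sum xi i) n m * rest).
  rewrite /m nth_bond_left nth_bond_right -asip_two_site_self//.
  rewrite mulr_suml; apply: eq_bigr => r _.
  rewrite (D_ASIPE _ _ i) set_bond_left set_bond_right.
  rewrite [\prod_(j < L | _) _](_ : _ = rest); first by rewrite mulrAC.
  by apply: eq_bigr => j ji; rewrite set_bond_other.
rewrite /n nth_bond_left nth_bond_right -asip_two_site_dual//.
rewrite mulr_suml; apply: eq_bigr => s _.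
have sm : (s <= nth 0%N xi i + nth 0%N xi i.+1)%N by rewrite -ltnS.
rewrite (D_ASIPE _ _ i) set_bond_left set_bond_right.
rewrite left_sum_set_bond//; last by rewrite ltn_eqF.
rewrite [\prod_(j < L | _) _](_ : _ = rest); first by rewrite mulrAC.
apply: eq_bigr => j ji; rewrite set_bond_other// left_sum_set_bond//.
by have /andP[_] := ji; rewrite -val_eqE.
Qed.

End AsipDuality.

(** * Improper integrals *)

Section ImproperIntegrals.
Context {R : realType}.
Notation mu := (@lebesgue_measure R).

Lemma is_derive_continuous (F : R -> R) (x df : R) :
  is_derive x 1 F df -> {for x, continuous F}.
Proof. by case=> dF _; exact/differentiable_continuous/derivable1_diffP. Qed.

Lemma continuous_within_itv (f : R -> R) (a b : R) :
  (forall x, a <= x <= b -> {for x, continuous f}) ->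
  {within `[a, b], continuous f}.
Proof.
move=> cf; apply: continuous_in_subspaceT => x /set_mem /=.
by rewrite in_itv /=; exact: cf.
Qed.

(** Monotone convergence along an exhaustion by segments. The derivative is a difference of
    nonnegative functions and the conclusion has no difference of integrals, so it holds even when
    both are infinite and can be used before integrability is known. *)
Lemma improper_FTC2 (a b : R^nat) (F g h : R -> R) (A B : R) :
  (forall n, a n < b n) -> nonincreasing_seq a -> nondecreasing_seq b ->
  let D := \bigcup_n `[a n, b n]%classic in
  (forall x, D x -> 0 <= g x) -> (forall x, D x -> 0 <= h x) ->
  (forall x, D x -> {for x, continuous g}) ->
  (forall x, D x -> {for x, continuous h}) ->
  (forall x, D x -> is_derive x 1 F (g x - h x)) ->
  F (a n) @[n --> \oo] --> A -> F (b n) @[n --> \oo] --> B ->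
  (\int[mu]_(x in D) (g x)%:E = \int[mu]_(x in D) (h x)%:E + (B - A)%:E)%E.
Proof.
move=> ab ai bi D g0 h0 cg ch dF FA FB.
have abD n x : a n <= x <= b n -> D x by move=> xab; exists n => //=; rewrite in_itv.
have cgn n : {within `[a n, b n], continuous g}.
  by apply: continuous_within_itv => x /abD; exact: cg.
have chn n : {within `[a n, b n], continuous h}.
  by apply: continuous_within_itv => x /abD; exact: ch.
have ign n : mu.-integrable `[a n, b n] (EFin \o g).
  by apply: continuous_compact_integrable => //; exact: segment_compact.
have ihn n : mu.-integrable `[a n, b n] (EFin \o h).
  by apply: continuous_compact_integrable => //; exact: segment_compact.
have step n : (\int[mu]_(x in `[a n, b n]) (g x)%:E =
    \int[mu]_(x in `[a n, b n]) (h x)%:E + (F (b n) - F (a n))%:E)%E.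
  rewrite EFinB -(continuous_FTC2 (f := fun x => g x - h x) (ab n)).
  - under [X in (_ + X)%E]eq_integral do rewrite EFinB.
    rewrite integralB_EFin//=.
    rewrite addeC subeK//.
    exact: integrable_fin_num.
  - apply: continuous_within_itv => x /abD Dx.
    by apply: cvgB; [exact: cg|exact: ch].
  - split.
    + move=> x; rewrite in_itv /= => /andP[ax xb].
      by have /dF[] : D x by apply: (abD n); rewrite !ltW.
    + apply: cvg_at_right_filter; apply: (@is_derive_continuous _ _ (g (a n) - h (a n))).
      by apply: dF; apply: (abD n); rewrite lexx ltW.
    + apply: cvg_at_left_filter; apply: (@is_derive_continuous _ _ (g (b n) - h (b n))).
      by apply: dF; apply: (abD n); rewrite lexx ltW.
  - move=> x; rewrite in_itv /= => /andP[ax xb]; rewrite derive1E.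
    have Dx : D x by apply: (abD n); rewrite !ltW.
    by have dFx := dF x Dx; rewrite derive_val.
have nd : nondecreasing_seq (fun n => `[a n, b n]%classic).
  move=> m n mn; apply/subsetPset => x /=; rewrite !in_itv /= => /andP[ax xb].
  by rewrite (le_trans (ai _ _ mn))//= (le_trans xb)// bi.
have lim (f : R -> R) : (forall x, D x -> 0 <= f x) ->
    (forall n, {within `[a n, b n], continuous f}) ->
    ((\int[mu]_(x in `[a n, b n]) (f x)%:E) @[n --> \oo] -->
     \int[mu]_(x in D) (f x)%:E)%E.
  move=> f0 cf; apply: ge0_nondecreasing_set_cvg_integral => //.
  - move=> n; apply/measurable_EFinP.
    exact: subspace_continuous_measurable_fun.
  - by move=> n x nx; rewrite lee_fin f0//; exists n.
have Lg := lim g g0 cgn; have Lh := lim h h0 chn.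
have LF : ((F (b n) - F (a n))%:E @[n --> \oo] --> (B - A)%:E)%E.
  by apply: cvg_EFin; [exact: nearW|exact: cvgB].
have {}Lh := cvgeD (fin_num_adde_defl _ _) Lh LF.
apply: (cvg_unique _ Lg) => //.
by move/funext: step => ->; exact: Lh.
Qed.

End ImproperIntegrals.

Section ImproperIntervals.
Context {R : realType}.
Notation mu := (@lebesgue_measure R).
Implicit Types (F g h : R -> R) (A B x : R).

Lemma harmonic_nonincreasing : nonincreasing_seq (@harmonic R).
Proof. by move=> m n mn; rewrite /harmonic lef_pV2 ?posrE// ler_nat ltnS. Qed.

Lemma harmonic_le1 n : harmonic n <= 1 :> R.
Proof. by rewrite /harmonic invf_le1// ler1n. Qed.

Lemma harmonic_lt x n : 0 < x -> x^-1 < n.+1%:R -> harmonic n < x.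
Proof. by move=> x0 xn; rewrite /harmonic invf_plt ?posrE. Qed.

Lemma FTC2_oy F g h A B :
  (forall x, 0 < x -> 0 <= g x) -> (forall x, 0 < x -> 0 <= h x) ->
  (forall x, 0 < x -> {for x, continuous g}) ->
  (forall x, 0 < x -> {for x, continuous h}) ->
  (forall x, 0 < x -> is_derive x 1 F (g x - h x)) ->
  F x @[x --> 0^'+] --> A -> F x @[x --> +oo] --> B ->
  (\int[mu]_(x in `]0%R, +oo[) (g x)%:E =
   \int[mu]_(x in `]0%R, +oo[) (h x)%:E + (B - A)%:E)%E.
Proof.
move=> g0 h0 cg ch dF FA FB.
(* The right end is [n.+2] because [n.+1] would meet [harmonic n] at [n = 0]. *)
have cover : [set` `]0, +oo[%R] = \bigcup_n `[@harmonic R n, n.+2%:R]%classic.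
  apply/seteqP; split => x /=.
    rewrite in_itv /= andbT => x0.
    have xn := truncnS_gt (x^-1 + x).
    exists (Num.truncn (x^-1 + x)) => //=; rewrite in_itv /=; apply/andP; split.
      by rewrite ltW// harmonic_lt// (le_lt_trans _ xn)// lerDl ltW.
    apply: (@le_trans _ _ (x^-1 + x)); first by rewrite lerDr invr_ge0 ltW.
    by rewrite (le_trans (ltW xn))// ler_nat.
  move=> [n _ /=]; rewrite !in_itv /= andbT => /andP[+ _].
  by apply: lt_le_trans; rewrite /harmonic invr_gt0.
have D0 x : (\bigcup_n `[@harmonic R n, n.+2%:R]%classic) x -> 0 < x.
  by rewrite -cover /= in_itv /= andbT.
rewrite cover; apply: (improper_FTC2 (F := F)).
- by move=> n; rewrite (le_lt_trans (harmonic_le1 n))// ltr1n.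
- exact: harmonic_nonincreasing.
- by move=> m n mn; rewrite ler_nat !ltnS.
- by move=> x /D0; exact: g0.
- by move=> x /D0; exact: h0.
- by move=> x /D0; exact: cg.
- by move=> x /D0; exact: ch.
- by move=> x /D0; exact: dF.
- apply: ((cvg_at_rightP F 0 A).1 FA); split.
    by move=> n; rewrite /harmonic invr_gt0.
  exact: cvg_harmonic.
- apply: ((cvg_pinftyP F B).1 FB).
  apply/cvgryPge => M; near=> n.
  apply: (@le_trans _ _ n%:R); last by rewrite ler_nat leqW.
  by near: n; exact: nbhs_infty_ger.
Unshelve. all: by end_near. Qed.

Lemma FTC2_01 F g h A B :
  (forall x, 0 < x < 1 -> 0 <= g x) -> (forall x, 0 < x < 1 -> 0 <= h x) ->
  (forall x, 0 < x < 1 -> {for x, continuous g}) ->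
  (forall x, 0 < x < 1 -> {for x, continuous h}) ->
  (forall x, 0 < x < 1 -> is_derive x 1 F (g x - h x)) ->
  F x @[x --> 0^'+] --> A -> F x @[x --> 1^'-] --> B ->
  (\int[mu]_(x in `]0%R, 1%R[) (g x)%:E =
   \int[mu]_(x in `]0%R, 1%R[) (h x)%:E + (B - A)%:E)%E.
Proof.
move=> g0 h0 cg ch dF FA FB.
(* The factor 1/3 keeps [a n] below [1 - a n] from [n = 0] on. *)
pose a n : R := 3^-1 * harmonic n; pose b n : R := 1 - a n.
have a0 n : 0 < a n by rewrite mulr_gt0// invr_gt0.
have a3 n : a n <= 3^-1 by rewrite ler_piMr// harmonic_le1.
have ah n : a n <= harmonic n.
  by rewrite ler_piMl ?invr_ge0// invf_le1// ler1n.
have ai : nonincreasing_seq a.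
  by move=> m n mn; rewrite ler_wpM2l// harmonic_nonincreasing.
have cover : [set` `]0, 1[%R] = \bigcup_n `[a n, b n]%classic.
  apply/seteqP; split => x /=.
    rewrite in_itv /= => /andP[x0 x1]; have x1' : 0 < 1 - x by rewrite subr_gt0.
    have xn := truncnS_gt (x^-1 + (1 - x)^-1).
    set m := Num.truncn _ in xn; exists m => //=.
    have ax : a m < x.
      rewrite (le_lt_trans (ah _))// harmonic_lt// (le_lt_trans _ xn)//.
      by rewrite lerDl invr_ge0 ltW.
    have ax1 : a m < 1 - x.
      rewrite (le_lt_trans (ah _))// harmonic_lt// (le_lt_trans _ xn)//.
      by rewrite lerDr invr_ge0 ltW.
    by rewrite in_itv /= /b; apply/andP; split; lra.
  move=> [n _ /=]; rewrite !in_itv /= => /andP[ax xb].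
  by rewrite (lt_le_trans (a0 n))//= (le_lt_trans xb)// /b ltrBlDr ltrDl.
have D0 x : (\bigcup_n `[a n, b n]%classic) x -> 0 < x < 1.
  by rewrite -cover /= in_itv.
have a_cvg : a n @[n --> \oo] --> 0.
  rewrite -[X in _ --> X](mulr0 3^-1); apply: cvgM; first exact: cvg_cst.
  exact: cvg_harmonic.
rewrite cover; apply: (improper_FTC2 (F := F)).
- by move=> n; rewrite /b; have := a3 n; lra.
- exact: ai.
- by move=> m n mn; rewrite lerB// ai.
- by move=> x /D0; exact: g0.
- by move=> x /D0; exact: h0.
- by move=> x /D0; exact: cg.
- by move=> x /D0; exact: ch.
- by move=> x /D0; exact: dF.
- by apply: ((cvg_at_rightP F 0 A).1 FA).
- apply: ((cvg_at_leftP F 1 B).1 FB); split.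
    by move=> n; rewrite /b ltrBlDr ltrDl.
  rewrite -[X in _ --> X](subr0 1); apply: cvgB => //; exact: cvg_cst.
Qed.

(** A nonnegative function with zero integral vanishes almost everywhere, so [D] would lie in a null
    set. *)
Lemma Rintegral_gt0 (D : set R) (f : R -> R) :
  measurable D -> (0 < mu D)%E -> (forall x, D x -> 0 < f x) ->
  mu.-integrable D (EFin \o f) -> 0 < \int[mu]_(x in D) f x.
Proof.
move=> mD muD f0 fi; rewrite lt0r; apply/andP; split; last first.
  by apply: Rintegral_ge0 => x /f0/ltW.
apply/eqP => f_eq0.
have : ae_eq mu D (EFin \o f) (cst 0%E).
  apply: (ae_eq_integral_abs mu mD (measurable_int mu fi)).1.
  transitivity (\int[mu]_(x in D) (EFin \o f) x)%E.
    by apply: eq_integral => x /set_mem /f0 fx0; rewrite /= gtr0_norm.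
  rewrite -[LHS]fineK ?integrable_fin_num//.
  by congr EFin.
move=> [N [mN N0 subN]].
have : (mu D <= mu N)%E.
  apply: le_measure; rewrite ?inE// => x Dx; apply: subN => /= /(_ Dx) [fx].
  by have := f0 x Dx; rewrite fx ltxx.
by rewrite N0 leNgt muD.
Qed.

End ImproperIntervals.

(** * Gamma and Beta integrals *)

Section GammaFunction.
Context {R : realType}.
Notation mu := (@lebesgue_measure R).
Implicit Types z x t : R.

Let continuous_expRN x : {for x, continuous (fun t => expR (- t))}.
Proof.
apply: continuous_comp => /=; first exact: opp_continuous.
exact: continuous_expR.
Qed.

(** The term of degree [N.+2] of the exponential series bounds the function by [(N.+2)!] over [x]
    for [x >= 1]. *)
Lemma powR_expR_cvgy z : x `^ z * expR (- x) @[x --> +oo] --> (0 : R).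
Proof.
pose N := Num.truncn z.
have zN : z <= N.+1%:R by exact/ltW/truncnS_gt.
apply: (@squeeze_cvgr _ _ _ _ (cst 0) (fun x => (N.+2)`!%:R * x^-1)).
- near=> x; have x1 : 1 <= x by near: x; exact: nbhs_pinfty_ge.
  have x0 : 0 < x by rewrite (lt_le_trans ltr01).
  rewrite mulr_ge0 ?powR_ge0 ?expR_ge0//=.
  apply: (@le_trans _ _ (x ^+ N.+1 * expR (- x))).
    by rewrite ler_wpM2r ?expR_ge0// -(powR_mulrn _ (ltW x0)) ler_powR.
  rewrite expRN ler_pdivrMr ?expR_gt0// mulrAC ler_pdivlMr//.
  have := expR_ge1Dxn N.+1 (ltW x0).
  rewrite -exprSr -ler_pdivrMl ?ltr0n ?fact_gt0// mulrC => ex.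
  by apply: le_trans ex; rewrite lerDr.
- exact: cvg_cst.
- rewrite -[X in _ --> X](mulr0 (N.+2)`!%:R); apply: cvgM; first exact: cvg_cst.
  apply/gtr0_cvgV0; last exact: cvg_id.
  by near=> x; near: x; exact: nbhs_pinfty_gt.
Unshelve. all: by end_near. Qed.

Let is_derive_powR_expR z x : 0 < x -> is_derive x 1
  (fun t => t `^ z * expR (- t)) (z * (x `^ (z - 1) * expR (- x)) - x `^ z * expR (- x)).
Proof.
move=> x0; have dz := is_derive1_powR z x0.
have dN : is_derive x 1 (-%R : R -> R) (- 1) by exact: is_deriveNid.
have de : is_derive x 1 (fun t : R => expR (- t)) (- expR (- x)).
  apply: (is_derive_eq (is_derive1_comp (is_derive_expR _) dN)).
  by rewrite mulrN1.
by apply: is_derive_eq; rewrite /GRing.scale /=; ring.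
Qed.

Lemma powR_expR_continuous z x : 0 < x ->
  {for x, continuous (fun t => t `^ z * expR (- t))}.
Proof. by move=> x0; apply: is_derive_continuous; exact: is_derive_powR_expR. Qed.

Let powR_expR_ge0 z x : 0 <= x `^ z * expR (- x).
Proof. by rewrite mulr_ge0 ?powR_ge0 ?expR_ge0. Qed.

Let measurable_expRN : measurable_fun [set: R] (fun x => expR (- x)).
Proof. by apply: measurableT_comp => //; exact: measurable_funN. Qed.

Let measurable_powR_expR z (D : set R) :
  measurable_fun D (fun x => (x `^ z * expR (- x))%:E).
Proof.
apply/measurable_EFinP/measurable_funTS; apply: measurable_funM => //.
Qed.

(** The function [x^z exp(- x)] vanishes at both ends, so the two parts of its derivative have equal
    integrals, finite or not. *)
Lemma Gamma_integral_rec z : 0 < z ->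
  (\int[mu]_(x in `]0%R, +oo[) (x `^ z * expR (- x))%:E =
   z%:E * \int[mu]_(x in `]0%R, +oo[) (x `^ (z - 1) * expR (- x))%:E)%E.
Proof.
move=> z0.
rewrite -ge0_integralZl//; last first.
- by rewrite lee_fin ltW.
- by move=> x _; rewrite lee_fin powR_expR_ge0.
- exact: measurable_powR_expR.
under [RHS]eq_integral do rewrite -EFinM.
rewrite -[LHS]adde0 -[X in (_ + X)%E]/((0 : R)%:E) -[X in X%:E](subrr 0).
apply/esym; apply: (FTC2_oy (F := fun x => x `^ z * expR (- x))
  (g := fun x => z * (x `^ (z - 1) * expR (- x)))
  (h := fun x => x `^ z * expR (- x))).
- by move=> x _; rewrite !mulr_ge0 ?powR_ge0 ?expR_ge0// ltW.
- by move=> x _; rewrite !mulr_ge0 ?powR_ge0 ?expR_ge0.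
- move=> x x0; apply: cvgM; first exact: cvg_cst.
  exact: powR_expR_continuous.
- by move=> x x0; exact: powR_expR_continuous.
- by move=> x x0; exact: is_derive_powR_expR.
- rewrite -[X in _ --> X](mul0r (expR (- 0))); apply: cvgM.
    exact: powR_cvg0.
  exact/cvg_at_right_filter/continuous_expRN.
- exact: powR_expR_cvgy.
Qed.

(* For [0 < z <= 1] through [z Gamma(z) = Gamma(z + 1)] and [x^z <= 1 + x]. *)
Lemma Gamma_integral_lty z : 0 < z ->
  (\int[mu]_(x in `]0%R, +oo[) (x `^ (z - 1) * expR (- x))%:E < +oo)%E.
Proof.
move=> z0; have [n zn] : exists n, z <= n.+1%:R.
  by exists (Num.truncn z); exact/ltW/truncnS_gt.
elim: n z z0 zn => [|n IH] z z0 zn.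
  have := Gamma_integral_rec z0.
  set I := (\int[mu]_(x in _) (x `^ (z - 1) * _)%:E)%E => recI.
  have : (z%:E * I < +oo)%E.
    rewrite -recI.
    apply: (@le_lt_trans _ _ (\int[mu]_(x in `]0%R, +oo[) ((1 + x) * expR (- x))%:E)%E).
      apply: ge0_le_integral => //.
      + by move=> x _; rewrite lee_fin powR_expR_ge0.
      + exact: measurable_powR_expR.
      + apply/measurable_EFinP/measurable_funTS; apply: measurable_funM.
          exact: measurable_funD.
        exact: measurable_expRN.
      + move=> x /=; rewrite in_itv /= andbT => x0.
        rewrite lee_fin ler_wpM2r ?expR_ge0//.
        have [x1|x1] := leP x 1.
          apply: (@le_trans _ _ 1); last by rewrite lerDl ltW.
          have <- : 1 `^ z = 1 by rewrite powR1.
          by rewrite ge0_ler_powR// ?nnegrE// ltW.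
        apply: (@le_trans _ _ (x `^ 1)); first by rewrite ler_powR// ltW.
        by rewrite (powRr1 (ltW x0)) lerDr.
    have -> : (\int[mu]_(x in `]0%R, +oo[) ((1 + x) * expR (- x))%:E =
        \int[mu]_(x in `]0%R, +oo[) (cst 0 x)%:E + (0 - - 2)%:E)%E; last first.
      by rewrite integral0 add0e ltry.
    (* The antiderivative [- (2 + x) exp(- x)], which rises from -2 to 0, is written with the powers
       0 and 1 so that the derivative and limits of [x^z exp(- x)] apply. *)
    apply: (FTC2_oy
      (F := fun x => - (2 * (x `^ 0 * expR (- x)) + x `^ 1 * expR (- x)))).
    + by move=> x x0; rewrite mulr_ge0 ?expR_ge0// addr_ge0// ltW.
    + by [].
    + move=> x _; apply: cvgM; last exact: continuous_expRN.
      by apply: cvgD; [exact: cvg_cst|exact: cvg_id].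
    + by move=> x _; exact: cvg_cst.
    + move=> x x0.
      have d0 := is_derive_powR_expR 0 x0. have d1 := is_derive_powR_expR 1 x0.
      apply: is_derive_eq.
      rewrite /GRing.scale /= powRr0 subrr powRr0 (powRr1 (ltW x0)). ring.
    + rewrite (_ : - 2 = - (2 * (1 * expR (- 0)) + 0 * expR (- 0))); last first.
        by rewrite oppr0 expR0; ring.
      have cexp := cvg_at_right_filter (continuous_expRN (x := 0)).
      apply: cvgN; apply: cvgD; apply: cvgM => //; first exact: cvg_cst.
        apply: cvgM => //; rewrite (_ : (fun x => x `^ 0) = cst 1); first exact: cvg_cst.
        by apply/funext => x; rewrite powRr0.
      exact: powR_cvg0.
    + rewrite (_ : 0 = - (2 * 0 + 0)); last by ring.
      apply: cvgN; apply: cvgD; last exact: powR_expR_cvgy.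
      by apply: cvgM; [exact: cvg_cst|exact: powR_expR_cvgy].
  rewrite !ltNge !leye_eq; apply: contra => /eqP ->.
  by rewrite gt0_muley// lte_fin.
have [z1|z1] := leP z 1.
  by apply: IH => //; rewrite (le_trans z1)// ler1n.
have z10 : 0 < z - 1 by rewrite subr_gt0.
rewrite (Gamma_integral_rec z10); apply: lte_mul_pinfty; rewrite ?lee_fin ?ltW//.
by apply: IH => //; rewrite lerBlDr natr1.
Qed.

Lemma Gamma_integrable z : 0 < z ->
  mu.-integrable `]0, +oo[ (fun x => (x `^ (z - 1) * expR (- x))%:E).
Proof.
move=> z0; apply/integrableP; split; first exact: measurable_powR_expR.
apply: le_lt_trans (Gamma_integral_lty z0); apply: ge0_le_integral => //.
- apply: measurableT_comp => //; exact: measurable_powR_expR.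
- exact: measurable_powR_expR.
- by move=> x _; rewrite lee_fin ger0_norm.
Qed.

Lemma Gamma_gt0 z : 0 < z -> 0 < Gamma z.
Proof.
move=> z0; apply: Rintegral_gt0 => //.
- by rewrite lebesgue_measure_itv /= ltry addye ?ltry.
- move=> x /=; rewrite in_itv /= andbT => x0.
  by rewrite mulr_gt0 ?powR_gt0 ?expR_gt0.
- exact: Gamma_integrable.
Qed.

Lemma GammaD1 z : 0 < z -> Gamma (z + 1) = z * Gamma z.
Proof.
move=> z0; rewrite /Gamma addrK /Rintegral Gamma_integral_rec//.
by rewrite fineM// integrable_fin_num//; exact: Gamma_integrable.
Qed.

(** The Pochhammer symbol. *)
Definition rise z n : R := \prod_(i < n) (z + i%:R).

Lemma riseS z n : rise z n.+1 = rise z n * (z + n%:R).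
Proof. by rewrite /rise big_ord_recr. Qed.

Lemma rise0 z : rise z 0 = 1.
Proof. by rewrite /rise big_ord0. Qed.

Lemma rise_gt0 z n : 0 < z -> 0 < rise z n.
Proof. by move=> z0; apply: prodr_gt0 => i _; rewrite ltr_wpDr. Qed.

Lemma GammaDn z n : 0 < z -> Gamma (z + n%:R) = rise z n * Gamma z.
Proof.
move=> z0; elim: n => [|n IH]; first by rewrite addr0 rise0 mul1r.
by rewrite -natr1 addrA GammaD1 ?ltr_wpDr// IH riseS mulrA [_ * rise _ _]mulrC.
Qed.

End GammaFunction.

(** * Beta integrals along a curve from 0 to 1 *)

Section BetaIntegral.
Context {R : realType}.
Notation mu := (@lebesgue_measure R).
Variables y dy : R -> R.
Hypothesis dyP : forall x : R, is_derive x 1 y (dy x).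
Hypothesis dy_cont : forall x : R, {for x, continuous dy}.
Hypothesis dy_gt0 : forall x, 0 < dy x.
Hypothesis y01 : forall x, 0 < x < 1 -> 0 < y x < 1.
Hypotheses (y0 : y 0 = 0) (y1 : y 1 = 1).
Implicit Types (a b x : R) (m n : nat).

(** The Beta density pulled back along [y]. The identity curve gives [Beta], and [abep_curve] gives
    the ABEP density. *)
Definition beta_kernel a b x : R := y x `^ a * (1 - y x) `^ b * dy x.

Definition beta_integral a b : R :=
  \int[mu]_(x in `]0, 1[) beta_kernel (a - 1) (b - 1) x.

Let y_gt0 x : 0 < x < 1 -> 0 < y x. Proof. by move=> /y01/andP[]. Qed.

Let ym_gt0 x : 0 < x < 1 -> 0 < 1 - y x.
Proof. by move=> /y01/andP[_]; rewrite subr_gt0. Qed.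

Lemma beta_kernel_ge0 a b x : 0 <= beta_kernel a b x.
Proof. by rewrite !mulr_ge0 ?powR_ge0// ltW. Qed.

Let ycont x : {for x, continuous y}.
Proof. exact: is_derive_continuous. Qed.

Let is_derive_ypow a x : 0 < y x ->
  is_derive x 1 (fun t => y t `^ a) (a * y x `^ (a - 1) * dy x).
Proof.
move=> yx0; apply: (is_derive1_comp (f := fun t => t `^ a)) => //.
exact: is_derive1_powR.
Qed.

Let is_derive_ympow b x : 0 < 1 - y x ->
  is_derive x 1 (fun t => (1 - y t) `^ b) (- (b * (1 - y x) `^ (b - 1) * dy x)).
Proof.
move=> yx1; rewrite -mulrN.
apply: (is_derive1_comp (f := fun t => t `^ b) (g := fun t => 1 - y t)).
  exact: is_derive1_powR.
by apply: is_derive_eq; rewrite add0r mul1r.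
Qed.

Lemma beta_kernel_continuous a b x : 0 < x < 1 ->
  {for x, continuous (beta_kernel a b)}.
Proof.
move=> x01; apply: cvgM; last exact: dy_cont.
apply: cvgM.
- exact/(is_derive_continuous (F := fun t => y t `^ a))/is_derive_ypow/y_gt0.
- exact/(is_derive_continuous (F := fun t => (1 - y t) `^ b))/is_derive_ympow/ym_gt0.
Qed.

Let y_cvg0 : y x @[x --> 0^'+] --> 0^'+.
Proof.
have yc : y x @[x --> 0^'+] --> (0 : R).
  by rewrite -{2}y0; apply: cvg_at_right_filter; exact: ycont.
move=> P [e /= e0 eP]; change (\forall x \near 0^'+, P (y x)).
near=> x; apply: eP => /=.
  by near: x; move/cvgrPdist_lt : yc => /(_ e e0).
by apply: y_gt0; apply/andP; split; near: x;
  [exact: nbhs_right_gt|exact: nbhs_right_lt].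
Unshelve. all: by end_near. Qed.

Let ym_cvg0 : (1 - y x) @[x --> 1^'-] --> 0^'+.
Proof.
have yc : (1 - y x) @[x --> 1^'-] --> (0 : R).
  have <- : 1 - y 1 = 0 by rewrite y1 subrr.
  apply: cvgB; first exact: cvg_cst.
  by apply: cvg_at_left_filter; exact: ycont.
move=> P [e /= e0 eP]; change (\forall x \near 1^'-, P (1 - y x)).
near=> x; apply: eP => /=.
  by near: x; move/cvgrPdist_lt : yc => /(_ e e0).
by apply: ym_gt0; apply/andP; split; near: x;
  [exact: nbhs_left_gt|exact: nbhs_left_lt].
Unshelve. all: by end_near. Qed.

Let ypow_cvg0 a : 0 < a -> y x `^ a @[x --> 0^'+] --> (0 : R).
Proof. by move=> a0; exact: (cvg_comp _ _ y_cvg0 (powR_cvg0 a0)). Qed.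

Let ympow_cvg0 b : 0 < b -> (1 - y x) `^ b @[x --> 1^'-] --> (0 : R).
Proof. by move=> b0; exact: (cvg_comp _ _ ym_cvg0 (powR_cvg0 b0)). Qed.

Let powR_le1 a x : 0 < a -> 0 < x < 1 -> x `^ a <= 1.
Proof.
move=> a0 /andP[x0 x1]; have <- : 1 `^ a = 1 :> R by rewrite powR1.
by rewrite ge0_ler_powR// ?nnegrE// ltW.
Qed.

Let ypow_cvg1 a : y x `^ a @[x --> 1^'-] --> (1 : R).
Proof.
have y1_gt0 : 0 < y 1 by rewrite y1.
have := cvg_at_left_filter (is_derive_continuous (is_derive_ypow a y1_gt0)).
by rewrite y1 powR1.
Qed.

Let ympow_cvg1 b : (1 - y x) `^ b @[x --> 0^'+] --> (1 : R).
Proof.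
have y0_lt1 : 0 < 1 - y 0 by rewrite y0 subr0.
have := cvg_at_right_filter (is_derive_continuous (is_derive_ympow b y0_lt1)).
by rewrite y0 subr0 powR1.
Qed.

Let itv01 x : `]0, 1[%classic x -> 0 < x < 1.
Proof. by rewrite /= in_itv. Qed.

Lemma measurable_beta_kernel a b (D : set R) :
  measurable_fun D (fun x => (beta_kernel a b x)%:E).
Proof.
have my : measurable_fun setT y.
  by apply: continuous_measurable_fun => x; exact: ycont.
apply/measurable_EFinP/measurable_funTS; apply: measurable_funM; last first.
  by apply: continuous_measurable_fun => x; exact: dy_cont.
apply: measurable_funM; apply: (measurableT_comp (measurable_powR _)) => //.
exact: measurable_funB.
Qed.

Local Notation ebeta a b :=
  (\int[mu]_(x in `]0%R, 1%R[) (beta_kernel a b x)%:E)%E.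

Let ebeta_scale c a b : 0 <= c ->
  (c%:E * ebeta a b = \int[mu]_(x in `]0%R, 1%R[) (c * beta_kernel a b x)%:E)%E.
Proof.
move=> c0; rewrite -ge0_integralZl//.
- exact: measurable_beta_kernel.
- by move=> x _; rewrite lee_fin beta_kernel_ge0.
Qed.

(** Here [y^a] is an antiderivative. Together with [ebeta_right] this supplies the integrals that
    dominate all the others. *)
Let ebeta_left a : 0 < a -> (a%:E * ebeta (a - 1) 0 = 1)%E.
Proof.
move=> a0; rewrite ebeta_scale ?ltW//.
transitivity (\int[mu]_(x in `]0%R, 1%R[) (cst 0 x)%:E + (1 - 0)%:E)%E; last first.
  by rewrite integral0 add0e subr0.
apply: (FTC2_01 (F := fun x => y x `^ a)) => //.
- by move=> x _; rewrite mulr_ge0 ?beta_kernel_ge0// ltW.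
- by move=> x x01; apply: cvgM; [exact: cvg_cst|exact: beta_kernel_continuous].
- by move=> x _; exact: cvg_cst.
- move=> x x01; apply: (is_derive_eq (is_derive_ypow a (y_gt0 x01))).
  by rewrite /beta_kernel powRr0 mulr1 subr0 mulrA.
- exact: ypow_cvg0.
Qed.

Let ebeta_right b : 0 < b -> (b%:E * ebeta 0 (b - 1) = 1)%E.
Proof.
move=> b0; rewrite ebeta_scale ?ltW//.
transitivity (\int[mu]_(x in `]0%R, 1%R[) (cst 0 x)%:E + (0 - - 1)%:E)%E; last first.
  by rewrite integral0 add0e sub0r opprK.
apply: (FTC2_01 (F := fun x => - (1 - y x) `^ b)) => //.
- by move=> x _; rewrite mulr_ge0 ?beta_kernel_ge0// ltW.
- by move=> x x01; apply: cvgM; [exact: cvg_cst|exact: beta_kernel_continuous].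
- by move=> x _; exact: cvg_cst.
- move=> x x01; have dx := is_derive_ympow b (ym_gt0 x01).
  apply: is_derive_eq; rewrite /beta_kernel powRr0 /cst; ring.
- by apply: cvgN; exact: ympow_cvg1.
- by rewrite -[X in _ --> X]oppr0; apply: cvgN; exact: ympow_cvg0.
Qed.

(** Integration by parts of [y^a (1 - y)^b], zero at both ends, in a form that presupposes no
    integrability. *)
Let ebeta_parts a b : 0 < a -> 0 < b ->
  (a%:E * ebeta (a - 1) b = b%:E * ebeta a (b - 1))%E.
Proof.
move=> a0 b0; rewrite !ebeta_scale ?ltW//.
rewrite -[RHS]adde0 -[X in (_ + X)%E]/((0 : R)%:E) -[X in X%:E](subrr 0).
apply: (FTC2_01 (F := fun x => y x `^ a * (1 - y x) `^ b)) => //.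
- by move=> x _; rewrite mulr_ge0 ?beta_kernel_ge0// ltW.
- by move=> x _; rewrite mulr_ge0 ?beta_kernel_ge0// ltW.
- by move=> x x01; apply: cvgM; [exact: cvg_cst|exact: beta_kernel_continuous].
- by move=> x x01; apply: cvgM; [exact: cvg_cst|exact: beta_kernel_continuous].
- move=> x x01; have da := is_derive_ypow a (y_gt0 x01).
  have db := is_derive_ympow b (ym_gt0 x01).
  by apply: is_derive_eq; rewrite /GRing.scale /= /beta_kernel; ring.
- by rewrite -[X in _ --> X](mul0r 1); apply: cvgM; [exact: ypow_cvg0|exact: ympow_cvg1].
- by rewrite -[X in _ --> X](mulr0 1); apply: cvgM; [exact: ypow_cvg1|exact: ympow_cvg0].
Qed.

Let beta_kernel_split a b x : 0 < x < 1 -> 0 < a -> 0 < b ->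
  beta_kernel (a - 1) (b - 1) x = beta_kernel a (b - 1) x + beta_kernel (a - 1) b x.
Proof.
move=> x01 a0 b0; rewrite /beta_kernel.
rewrite -(mulr_powRB1 (ltW (y_gt0 x01)) a0) -(mulr_powRB1 (ltW (ym_gt0 x01)) b0).
ring.
Qed.

(** Multiply by [y + (1 - y) = 1]; bounding [y^a] by 1 in one part and [(1 - y)^b] in the other
    leaves the two endpoint integrals. *)
Let ebeta_lty a b : 0 < a -> 0 < b -> (ebeta (a - 1) (b - 1) < +oo)%E.
Proof.
move=> a0 b0.
have fin (c : R) (I : \bar R) : 0 < c -> (c%:E * I = 1)%E -> (I < +oo)%E.
  move=> c0 cI; rewrite ltNge leye_eq; apply/eqP => Ioo.
  by move: cI; rewrite Ioo gt0_muley// lte_fin.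
have Ia := fin _ _ a0 (ebeta_left a0); have Ib := fin _ _ b0 (ebeta_right b0).
apply: (@le_lt_trans _ _ (ebeta 0 (b - 1) + ebeta (a - 1) 0)%E); last first.
  exact: lte_add_pinfty.
rewrite -ge0_integralD//; last 4 first.
- by move=> x _; rewrite lee_fin beta_kernel_ge0.
- exact: measurable_beta_kernel.
- by move=> x _; rewrite lee_fin beta_kernel_ge0.
- exact: measurable_beta_kernel.
apply: ge0_le_integral => //.
- by move=> x _; rewrite lee_fin beta_kernel_ge0.
- exact: measurable_beta_kernel.
- by apply: emeasurable_funD; exact: measurable_beta_kernel.
move=> x /itv01 x01; rewrite -EFinD lee_fin beta_kernel_split// /beta_kernel !powRr0.
rewrite lerD// ler_wpM2r ?(ltW (dy_gt0 x))// ?mul1r ?mulr1.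
  by rewrite ler_piMl ?powR_ge0// powR_le1// y01.
rewrite ler_piMr ?powR_ge0// powR_le1//.
by have /andP[yx0 yx1] := y01 x01; apply/andP; split; lra.
Qed.

Lemma beta_kernel_integrable a b : 0 < a -> 0 < b ->
  mu.-integrable `]0, 1[ (EFin \o beta_kernel (a - 1) (b - 1)).
Proof.
move=> a0 b0; apply/integrableP; split; first exact: measurable_beta_kernel.
apply: le_lt_trans (ebeta_lty a0 b0); apply: ge0_le_integral => //.
- by apply: measurableT_comp => //; exact: measurable_beta_kernel.
- exact: measurable_beta_kernel.
- by move=> x _; rewrite lee_fin ger0_norm ?beta_kernel_ge0.
Qed.

Lemma beta_integral_cc a b :
  \int[mu]_(x in `[0, 1]) beta_kernel (a - 1) (b - 1) x = beta_integral a b.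
Proof.
rewrite /beta_integral /Rintegral integral_itv_bndoo//.
exact: measurable_beta_kernel.
Qed.

Lemma beta_kernel_integrable_cc a b : 0 < a -> 0 < b ->
  mu.-integrable `[0, 1] (EFin \o beta_kernel (a - 1) (b - 1)).
Proof.
move=> a0 b0; apply/integrableP; split; first exact: measurable_beta_kernel.
rewrite integral_itv_bndoo; first by have /integrableP[] := beta_kernel_integrable a0 b0.
by apply: measurableT_comp => //; exact: measurable_beta_kernel.
Qed.

Lemma beta_integral_gt0 a b : 0 < a -> 0 < b -> 0 < beta_integral a b.
Proof.
move=> a0 b0; apply: Rintegral_gt0 => //.
- by rewrite lebesgue_measure_itv /= lte_fin ltr01 oppr0 adde0 lte_fin.
- move=> x /itv01 x01.
  by rewrite !mulr_gt0 ?powR_gt0// ?y_gt0 ?ym_gt0.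
- exact: beta_kernel_integrable.
Qed.

Lemma beta_integral_split a b : 0 < a -> 0 < b ->
  beta_integral a b = beta_integral (a + 1) b + beta_integral a (b + 1).
Proof.
move=> a0 b0; rewrite /beta_integral !addrK -RintegralD//.
- by apply: eq_Rintegral => x /set_mem/itv01 x01; exact: beta_kernel_split.
- by have := beta_kernel_integrable (addr_gt0 a0 ltr01) b0; rewrite addrK.
- by have := beta_kernel_integrable a0 (addr_gt0 b0 ltr01); rewrite addrK.
Qed.

Lemma beta_integral_parts a b : 0 < a -> 0 < b ->
  a * beta_integral a (b + 1) = b * beta_integral (a + 1) b.
Proof.
move=> a0 b0; rewrite /beta_integral !addrK /Rintegral.
have := congr1 fine (ebeta_parts a0 b0); rewrite !fineM//.
- apply: integrable_fin_num => //.
  by have := beta_kernel_integrable (addr_gt0 a0 ltr01) b0; rewrite addrK.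
- apply: integrable_fin_num => //.
  by have := beta_kernel_integrable a0 (addr_gt0 b0 ltr01); rewrite addrK.
Qed.

(** Splitting and integration by parts are two linear equations for the two integrals with a raised
    parameter. *)
Lemma beta_integralS a b : 0 < a -> 0 < b ->
  (a + b) * beta_integral (a + 1) b = a * beta_integral a b.
Proof.
move=> a0 b0; rewrite (beta_integral_split a0 b0) mulrDr beta_integral_parts//.
ring.
Qed.

Lemma beta_integralSr a b : 0 < a -> 0 < b ->
  (a + b) * beta_integral a (b + 1) = b * beta_integral a b.
Proof.
move=> a0 b0; rewrite (beta_integral_split a0 b0) mulrDr -beta_integral_parts//.
ring.
Qed.

(** Ratios of Beta integrals do not depend on the curve, which makes the ABEP moments and the
    Beta-Binomial weights match. *)
Lemma beta_integralD a b m n : 0 < a -> 0 < b ->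
  rise (a + b) (m + n) * beta_integral (a + m%:R) (b + n%:R) =
  rise a m * rise b n * beta_integral a b.
Proof.
move=> a0 b0; elim: m => [|m IHm].
  rewrite add0n rise0 mul1r addr0; elim: n => [|n IHn].
    by rewrite !rise0 !mul1r addr0.
  rewrite !riseS -[n.+1%:R]natr1 !addrA -mulrA -[a + b + _]addrA.
  by rewrite beta_integralSr ?ltr_wpDr// mulrCA IHn; ring.
rewrite addSn !riseS -[m.+1%:R]natr1 !addrA -mulrA.
have -> : a + b + (m + n)%:R = (a + m%:R) + (b + n%:R) by rewrite natrD; ring.
by rewrite beta_integralS ?ltr_wpDr// mulrCA IHm; ring.
Qed.

End BetaIntegral.

(** * The ABEP-SIP duality *)

Section Sip.
Context {R : realType}.
Variable k : R.
Hypothesis k0 : 0 < k.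
Implicit Types (a b : R) (m n r s : nat).

(** The Chu-Vandermonde identity. Writing [a + b + n] as [(a + r) + (b + (n - r))] raises one of the
    two factors, and Pascal's rule recombines the terms. *)
Lemma rise_vandermonde a b n :
  \sum_(r < n.+1) 'C(n, r)%:R * rise a r * rise b (n - r) = rise (a + b) n.
Proof.
elim: n => [|n IH]; first by rewrite big_ord1 bin0 !rise0 !mul1r.
rewrite riseS -IH mulr_suml.
rewrite (eq_bigr (fun r : 'I_n.+1 =>
   'C(n, r)%:R * rise a r.+1 * rise b (n - r) +
   'C(n, r)%:R * rise a r * rise b (n.+1 - r))); last first.
  move=> r _; have rn : (r <= n)%N by rewrite -ltnS.
  have nE : n%:R = r%:R + (n - r)%:R :> R by rewrite -natrD subnKC.
  by rewrite subSn// !riseS nE; ring.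
rewrite big_split /= big_ord_recl [X in _ = _ + X]big_ord_recl /=.
rewrite addrCA !bin0 !mul1r !rise0 !mul1r subn0; congr (_ + _).
have -> : \sum_(i < n) 'C(n, bump 0 i)%:R * rise a (bump 0 i) * rise b (n.+1 - bump 0 i)
  = \sum_(i < n.+1) 'C(n, i.+1)%:R * rise a i.+1 * rise b (n - i).
  rewrite big_ord_recr /= bin_small// !mul0r addr0.
  by apply: eq_bigr => i _; rewrite /bump /= add1n subSS.
rewrite -big_split /=; apply: eq_bigr => i _.
by rewrite /bump /= add1n subSS binS natrD; ring.
Qed.

Lemma Beta_beta_integral a b :
  Beta a b = beta_integral id (cst 1) a b :> R.
Proof. by apply: eq_Rintegral => x _; rewrite /beta_kernel mulr1. Qed.

Let k2_gt0 : 0 < 2 * k. Proof. by rewrite mulr_gt0. Qed.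

Let rise2_neq0 n : rise (2 * k) n != 0.
Proof. by rewrite gt_eqF// rise_gt0. Qed.

Let rise4_neq0 n : rise (4 * k) n != 0.
Proof. by rewrite gt_eqF// rise_gt0// mulr_gt0. Qed.

Lemma nu_SIPE r n : (r <= n)%N ->
  nu_SIP k r n = 'C(n, r)%:R * rise (2 * k) r * rise (2 * k) (n - r) / rise (4 * k) n.
Proof.
move=> rn; rewrite /nu_SIP !Beta_beta_integral.
have idP (x : R) : is_derive x 1 id (cst 1 x) by exact: is_derive_id.
have idc (x : R) : {for x, continuous (cst (1 : R))} by exact: cvg_cst.
have id0 (x : R) : 0 < cst 1 x :> R by [].
have id01 (x : R) : 0 < x < 1 -> 0 < id x < 1 by [].
have := beta_integralD idP idc id0 id01 erefl erefl r (n - r) k2_gt0 k2_gt0.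
have B0 := beta_integral_gt0 idP idc id0 id01 erefl erefl k2_gt0 k2_gt0.
rewrite subnKC// [2 * k + r%:R]addrC [2 * k + (n - r)%:R]addrC.
have -> : 2 * k + 2 * k = 4 * k by ring.
move=> H; apply: (mulfI (rise4_neq0 n)).
rewrite mulrCA [rise _ _ * (_ / _)]mulrA H mulfK ?gt_eqF//.
by rewrite [RHS]mulrC divfK// mulrA.
Qed.

Lemma sum_nu_SIP n : \sum_(r < n.+1) nu_SIP k r n = 1.
Proof.
rewrite (eq_bigr (fun r : 'I_n.+1 => 'C(n, r)%:R * rise (2 * k) r *
    rise (2 * k) (n - r) / rise (4 * k) n)); last first.
  by move=> r _; rewrite nu_SIPE// -ltnS.
rewrite -mulr_suml rise_vandermonde.
have -> : 2 * k + 2 * k = 4 * k by ring.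
by rewrite divff.
Qed.

(** The Pochhammer symbols of the duality function cancel those of the weight, and the binomial
    theorem remains. *)
Lemma sip_two_site (u v : R) m :
  \sum_(s < m.+1) (u ^+ s / rise (2 * k) s) * (v ^+ (m - s) / rise (2 * k) (m - s))
    * nu_SIP k s m = (u + v) ^+ m / rise (4 * k) m.
Proof.
rewrite addrC exprDn mulr_suml; apply: eq_bigr => s _.
have sm : (s <= m)%N by rewrite -ltnS.
rewrite nu_SIPE// -[_ *+ 'C(_, _)]mulr_natl; field.
by rewrite !rise2_neq0 rise4_neq0.
Qed.

End Sip.

(** * The ABEP redistribution density and its moments *)

Section Abep.
Context {R : realType} {L : nat}.
Variables sigma k : R.
Hypotheses (sigma0 : 0 < sigma) (k0 : 0 < k).
Notation mu := (@lebesgue_measure R).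
Implicit Types (x : L.-tuple R) (xi : L.-tuple nat) (E w : R).

Let k2_gt0 : 0 < 2 * k. Proof. by rewrite mulr_gt0. Qed.

Section Curve.
Variable E : R.
Hypothesis E0 : 0 < E.
Let s := 2 * sigma * E.
Let c := 1 - expR (- s).

Let s0 : 0 < s. Proof. by rewrite !mulr_gt0. Qed.

Let c0 : 0 < c. Proof. by rewrite subr_gt0 -expR0 ltr_expR oppr_lt0. Qed.

(** Besides turning the redistribution density into a Beta density, this is the share of the left
    site in the sum of the two bases of the duality function on the bond, see [slope_split]. *)
Definition abep_curve w : R := (expR (- (s * (1 - w))) - expR (- s)) / c.

Definition abep_curve_der w : R := s * expR (- (s * (1 - w))) / c.

Let curveP w : is_derive w 1 abep_curve (abep_curve_der w).
Proof.
have d1 : is_derive w 1 (fun w : R => - (s * (1 - w))) s.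
  by apply: is_derive_eq; rewrite /GRing.scale /=; ring.
have d2 : is_derive w 1 (fun w : R => expR (- (s * (1 - w))))
    (expR (- (s * (1 - w))) * s).
  exact: (is_derive1_comp (is_derive_expR _) d1).
by apply: is_derive_eq; rewrite /abep_curve_der /GRing.scale /=; ring.
Qed.

Let curve_der_cont w : {for w, continuous abep_curve_der}.
Proof.
have d1 : is_derive w 1 (fun w : R => - (s * (1 - w))) s.
  by apply: is_derive_eq; rewrite /GRing.scale /=; ring.
apply: cvgM; last exact: cvg_cst.
apply: cvgM; first exact: cvg_cst.
exact: (is_derive_continuous (F := fun w => expR (- (s * (1 - w))))).
Qed.

Let curve_der_gt0 w : 0 < abep_curve_der w.
Proof. by rewrite divr_gt0// mulr_gt0// expR_gt0. Qed.

Lemma abep_curve0 : abep_curve 0 = 0.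
Proof. by rewrite /abep_curve subr0 mulr1 subrr mul0r. Qed.

Lemma abep_curve1 : abep_curve 1 = 1.
Proof. by rewrite /abep_curve subrr mulr0 oppr0 expR0 divff// gt_eqF. Qed.

Let oneB_curve w : 1 - abep_curve w = (1 - expR (- (s * (1 - w)))) / c.
Proof.
rewrite /abep_curve -[X in X - _](divff (lt0r_neq0 c0)) -mulrBl /c.
by congr (_ / _); ring.
Qed.

Let curve01 w : 0 < w < 1 -> 0 < abep_curve w < 1.
Proof.
move=> /andP[w0 w1]; apply/andP; split.
  rewrite divr_gt0// subr_gt0 ltr_expR ltrN2 -[ltRHS]mulr1 ltr_pM2l//.
  by rewrite ltrBlDr ltrDl.
rewrite -subr_gt0 oneB_curve divr_gt0// subr_gt0 -[ltRHS]expR0 ltr_expR oppr_lt0.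
by rewrite mulr_gt0// subr_gt0.
Qed.

Let curve_cc w : 0 <= w <= 1 -> 0 <= abep_curve w /\ 0 <= 1 - abep_curve w.
Proof.
move=> /andP[w0 w1]; have s0' := ltW s0.
split; last first.
  rewrite oneB_curve divr_ge0 ?(ltW c0)// subr_ge0 -[leRHS]expR0 ler_expR oppr_le0.
  by rewrite mulr_ge0// subr_ge0.
rewrite divr_ge0 ?(ltW c0)// subr_ge0 ler_expR lerN2 ler_piMr//.
by rewrite gerBl.
Qed.

(** The exponential [exp(s w)] is [expR s * c / s] times the derivative of the curve, and the
    product inside the power is [expR s * c * c] times [y (1 - y)]. The constant cancels on
    normalization. *)
Let weight_const : R := expR s * c / s * (expR s * c * c) `^ (2 * k - 1).

Let weight_const_gt0 : 0 < weight_const.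
Proof. by rewrite mulr_gt0// ?powR_gt0// ?divr_gt0 ?mulr_gt0 ?expR_gt0. Qed.

Lemma nu_ABEP_weightE w : 0 <= w <= 1 -> nu_ABEP_weight sigma k w E =
  weight_const * beta_kernel abep_curve abep_curve_der (2 * k - 1) (2 * k - 1) w.
Proof.
move=> w01; have [y0 y1] := curve_cc w01.
have es : expR (s * w) = expR s * expR (- (s * (1 - w))).
  by rewrite -expRD; congr expR; ring.
have c_neq0 : c != 0 by rewrite gt_eqF.
have s_neq0 : s != 0 by rewrite gt_eqF.
rewrite /nu_ABEP_weight -/s /beta_kernel /weight_const.
have -> : expR (s * w) - 1 = expR s * c * abep_curve w.
  rewrite es /abep_curve -mulrA [c * _]mulrC divfK// [expR s * (_ - _)]mulrBr.
  by rewrite [expR (- s)]expRN mulfV// gt_eqF// expR_gt0.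
have -> : 1 - expR (- (s * (1 - w))) = c * (1 - abep_curve w).
  by rewrite oneB_curve [RHS]mulrC divfK.
have -> : expR s * c * abep_curve w * (c * (1 - abep_curve w)) =
    expR s * c * c * (abep_curve w * (1 - abep_curve w)) by ring.
have esc : 0 <= expR s * c * c by rewrite !mulr_ge0 ?expR_ge0// ltW.
rewrite (powRM _ esc (mulr_ge0 y0 y1)) (powRM _ y0 y1) es /abep_curve_der.
by field; rewrite s_neq0 c_neq0.
Qed.

Let curve_pow_kernel r t w : 0 <= w <= 1 ->
  abep_curve w ^+ r * (1 - abep_curve w) ^+ t *
    beta_kernel abep_curve abep_curve_der (2 * k - 1) (2 * k - 1) w =
  beta_kernel abep_curve abep_curve_der (2 * k + r%:R - 1) (2 * k + t%:R - 1) w.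
Proof.
move=> w01; have [y0 y1] := curve_cc w01.
have pow (z : R) n : 0 <= z -> z ^+ n * z `^ (2 * k - 1) = z `^ (2 * k + n%:R - 1).
  move=> z0; elim: n => [|n IH]; first by rewrite expr0 mul1r addr0.
  rewrite exprS -mulrA IH mulr_powRB1//; last by rewrite ltr_wpDr.
  by congr (_ `^ _); rewrite -natr1; ring.
by rewrite /beta_kernel -!pow//; ring.
Qed.

(** The constants [C] and [D] carry the sites off the bond and the subtracted value, so that a whole
    term of the generator is computed at once, as a ratio of Beta integrals. *)
Lemma nu_ABEP_moment r t (C D : R) :
  \int[mu]_(w in `[0, 1])
    ((C * (abep_curve w ^+ r * (1 - abep_curve w) ^+ t) - D) * nu_ABEP sigma k w E) =
  C * (rise (2 * k) r * rise (2 * k) t / rise (4 * k) (r + t)) - D.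
Proof.
pose B a b := beta_integral abep_curve abep_curve_der a b.
have kint a b := beta_kernel_integrable_cc curveP curve_der_cont curve_der_gt0
  curve01 abep_curve0 abep_curve1 (a := a) (b := b).
have ZE : \int[mu]_(u in `[0, 1]) nu_ABEP_weight sigma k u E =
    weight_const * B (2 * k) (2 * k).
  rewrite /B -(beta_integral_cc curveP curve_der_cont).
  rewrite -RintegralZl//; last exact: kint.
  apply: eq_Rintegral => w /set_mem /=; rewrite in_itv /= => w01.
  exact: nu_ABEP_weightE.
have B0 : 0 < B (2 * k) (2 * k).
  exact: (beta_integral_gt0 curveP curve_der_cont curve_der_gt0 curve01
    abep_curve0 abep_curve1).
have B_neq0 : B (2 * k) (2 * k) != 0 by rewrite gt_eqF.
have K_neq0 : weight_const != 0 by rewrite gt_eqF.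
have kr : 0 < 2 * k + r%:R by rewrite ltr_wpDr.
have kt : 0 < 2 * k + t%:R by rewrite ltr_wpDr.
transitivity (\int[mu]_(w in `[0, 1])
  (C / B (2 * k) (2 * k) *
     beta_kernel abep_curve abep_curve_der (2 * k + r%:R - 1) (2 * k + t%:R - 1) w -
   D / B (2 * k) (2 * k) *
     beta_kernel abep_curve abep_curve_der (2 * k - 1) (2 * k - 1) w)).
  apply: eq_Rintegral => w /set_mem /=; rewrite in_itv /= => w01.
  rewrite /nu_ABEP ZE nu_ABEP_weightE// -curve_pow_kernel//.
  by field; rewrite B_neq0 K_neq0.
have intZ (a b e : R) : 0 < a -> 0 < b -> mu.-integrable `[0, 1]
    (EFin \o (fun w => e * beta_kernel abep_curve abep_curve_der (a - 1) (b - 1) w)).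
  by move=> a0 b0; exact: (integrableZl _ e (kint a b a0 b0)).
rewrite RintegralB//; [|exact: intZ|exact: intZ].
rewrite !RintegralZl//; [|exact: kint|exact: kint].
rewrite !(beta_integral_cc curveP curve_der_cont) -/(B _ _) -/(B _ _).
rewrite divfK//; congr (_ - _).
have := beta_integralD curveP curve_der_cont curve_der_gt0 curve01
  abep_curve0 abep_curve1 r t k2_gt0 k2_gt0.
rewrite -/(B _ _) -/(B _ _) => H.
have -> : 4 * k = 2 * k + 2 * k by ring.
have r0 : rise (2 * k + 2 * k) (r + t) != 0.
  by rewrite gt_eqF// rise_gt0// addr_gt0.
rewrite -mulrA; congr (_ * _).
apply: (mulfI r0); rewrite mulrCA H [RHS]mulrC divfK//.
by rewrite mulrCA mulVf// mulr1.
Qed.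

End Curve.
End Abep.

(** * Duality of the ABEP and SIP generators *)

Section AbepDuality.
Context {R : realType} {L : nat}.
Variables sigma k : R.
Hypotheses (sigma0 : 0 < sigma) (k0 : 0 < k).
Notation mu := (@lebesgue_measure R).
Implicit Types (x : L.-tuple R) (xi : L.-tuple nat).

Let k2_gt0 : 0 < 2 * k. Proof. by rewrite mulr_gt0. Qed.

Let rise2_neq0 n : rise (2 * k) n != 0.
Proof. by rewrite gt_eqF// rise_gt0. Qed.

Lemma tail_energyS x (j : 'I_L) : tail_energy x j = tnth x j + tail_energy x j.+1.
Proof.
rewrite /tail_energy (bigD1 j)//=; congr (_ + _); apply: eq_bigl => l.
by rewrite -val_eqE /= ltn_neqAle eq_sym andbC.
Qed.

Lemma tail_energy_set_bond x (i : 'I_L.-1) a b j :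
  a + b = tnth x (bond_left i) + tnth x (bond_right i) -> j != i.+1 ->
  tail_energy (set_bond x i a b) j = tail_energy x j.
Proof.
move=> ab ji; rewrite /tail_energy big_mkcond (big_bond _ i) [RHS]big_mkcond.
rewrite [RHS](big_bond _ i) /= set_bond_left set_bond_right !addrA; congr (_ + _).
  have -> : (j <= i.+1)%N = (j <= i)%N by rewrite leq_eqVlt (negbTE ji).
  by case: ifP.
by apply: eq_bigr => l li; rewrite set_bond_other.
Qed.

Lemma tail_energy_ge0 x j : nonneg_configs x -> 0 <= tail_energy x j.
Proof. by move=> x0; apply: sumr_ge0. Qed.

(** The base of the power at site [j]. The two bases of a bond telescope, so redistribution of the
    energy of the bond preserves their sum [scale]. *)
Definition abep_slope x (j : nat) : R :=
  (expR (- (2 * sigma * tail_energy x j.+1)) -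
   expR (- (2 * sigma * tail_energy x j))) / (2 * sigma).

Lemma D_ABEPE x xi : D_ABEP sigma k x xi =
  \prod_(j < L) (abep_slope x j ^+ tnth xi j / rise (2 * k) (tnth xi j)).
Proof.
apply: eq_bigr => j _; rewrite GammaDn//.
have G0 : Gamma (2 * k) != 0 by rewrite gt_eqF// Gamma_gt0.
by rewrite -/(abep_slope x j); field; rewrite G0 rise2_neq0.
Qed.

Lemma D_ABEP_bondE x xi (i : 'I_L.-1) : D_ABEP sigma k x xi =
  abep_slope x i ^+ tnth xi (bond_left i) / rise (2 * k) (tnth xi (bond_left i)) *
  (abep_slope x i.+1 ^+ tnth xi (bond_right i) /
    rise (2 * k) (tnth xi (bond_right i))) *
  \prod_(j < L | (j != bond_left i) && (j != bond_right i))
    (abep_slope x j ^+ tnth xi j / rise (2 * k) (tnth xi j)).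
Proof. by rewrite D_ABEPE (big_bond _ i) /= mulrA. Qed.

Let scale x (i : 'I_L.-1) : R := expR (- (2 * sigma * tail_energy x i.+2)) *
  (1 - expR (- (2 * sigma * (tnth x (bond_left i) + tnth x (bond_right i))))) /
  (2 * sigma).

Let tail_energy_bond x (i : 'I_L.-1) : tail_energy x i =
  (tnth x (bond_left i) + tnth x (bond_right i)) + tail_energy x i.+2.
Proof.
rewrite (tail_energyS x (bond_left i)) /= (tail_energyS x (bond_right i)) /=.
by rewrite addrA.
Qed.

Lemma abep_slope_sum x (i : 'I_L.-1) :
  abep_slope x i + abep_slope x i.+1 = scale x i.
Proof.
rewrite /abep_slope /scale tail_energy_bond.
set E := tnth _ _ + _; set T := tail_energy x i.+2.
by rewrite [2 * sigma * (E + T)]mulrDr [- (_ + 2 * sigma * T)]opprD expRD; ring.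
Qed.

Let slope_split x (i : 'I_L.-1) w :
  let E := tnth x (bond_left i) + tnth x (bond_right i) in
  let z := set_bond x i (w * E) ((1 - w) * E) in 0 < E ->
  abep_slope z i = scale x i * abep_curve sigma E w /\
  abep_slope z i.+1 = scale x i * (1 - abep_curve sigma E w).
Proof.
move=> E z E0.
have Ez j : j != i.+1 -> tail_energy z j = tail_energy x j.
  by apply: tail_energy_set_bond; rewrite -/E; ring.
have zr : tail_energy z i.+1 = (1 - w) * E + tail_energy x i.+2.
  rewrite (tail_energyS z (bond_right i)) /= set_bond_right Ez//.
  by rewrite eqn_leq ltnn.
have xl : tail_energy z i = E + tail_energy x i.+2.
  by rewrite Ez ?ltn_eqF// tail_energy_bond.
have c0 : 1 - expR (- (2 * sigma * E)) != 0.
  by rewrite gt_eqF// subr_gt0 -[ltRHS]expR0 ltr_expR oppr_lt0 !mulr_gt0.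
have s0 : sigma != 0 by rewrite gt_eqF.
rewrite /abep_slope zr xl Ez ?eqn_leq ?ltnn// /scale -/E /abep_curve.
set T := tail_energy x i.+2.
have -> : expR (- (2 * sigma * ((1 - w) * E + T))) =
    expR (- (2 * sigma * T)) * expR (- (2 * sigma * E * (1 - w))).
  by rewrite -expRD; congr expR; ring.
have -> : expR (- (2 * sigma * (E + T))) =
    expR (- (2 * sigma * T)) * expR (- (2 * sigma * E)).
  by rewrite -expRD; congr expR; ring.
by split; field; rewrite c0 s0.
Qed.

(** Both sides are a thermalized value minus [D_ABEP]. Thermalizing the dual gives a power of
    [scale] by [sip_two_site]; thermalizing the energies gives the same power times a moment of [y]
    and [1 - y]. *)
Lemma abep_bond_dual x xi (i : 'I_L.-1) : nonneg_configs x ->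
  let E := nth 0 x i + nth 0 x i.+1 in
  (if E == 0 then 0 else
    \int[mu]_(w in `[0, 1])
      ((D_ABEP sigma k (set_bond x i (w * E) ((1 - w) * E)) xi -
        D_ABEP sigma k x xi) * nu_ABEP sigma k w E)) =
  let n := (nth 0%N xi i + nth 0%N xi i.+1)%N in
  \sum_(r < n.+1) (D_ABEP sigma k x (set_bond xi i r (n - r)%N) -
    D_ABEP sigma k x xi) * nu_SIP k r n.
Proof.
move=> x0 /=; rewrite !nth_bond_left !nth_bond_right.
set E := tnth x _ + _; set n := (tnth xi _ + _)%N.
pose rest := \prod_(j < L | (j != bond_left i) && (j != bond_right i))
    (abep_slope x j ^+ tnth xi j / rise (2 * k) (tnth xi j)).
have -> : \sum_(r < n.+1) (D_ABEP sigma k x (set_bond xi i r (n - r)%N) -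
    D_ABEP sigma k x xi) * nu_SIP k r n =
    scale x i ^+ n / rise (4 * k) n * rest - D_ABEP sigma k x xi.
  under eq_bigr do rewrite mulrBl.
  rewrite sumrB -mulr_sumr sum_nu_SIP// mulr1; congr (_ - _).
  rewrite -abep_slope_sum -sip_two_site// mulr_suml; apply: eq_bigr => r _.
  rewrite (D_ABEP_bondE _ _ i) set_bond_left set_bond_right.
  rewrite [\prod_(j < L | _) _](_ : _ = rest); first by rewrite mulrAC.
  by apply: eq_bigr => j ji; rewrite set_bond_other.
have E_ge0 : 0 <= E by rewrite addr_ge0.
(* At zero energy the ABEP term is 0 by convention. The dual side is 0 too: the slopes and [scale]
   vanish, and without dual particles on the bond all powers are 1 and the difference cancels. *)
have [E_eq0|E_neq0] := eqVneq E 0.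
  have s0 : scale x i = 0.
    by rewrite /scale -/E E_eq0 mulr0 oppr0 expR0 subrr mulr0 mul0r.
  have [xl xr] : tnth x (bond_left i) = 0 /\ tnth x (bond_right i) = 0.
    move/eqP: E_eq0; rewrite paddr_eq0 ?x0// => /andP[/eqP-> /eqP->] //.
  have sl : abep_slope x i = 0.
    by rewrite /abep_slope (tail_energyS x (bond_left i)) /= xl add0r subrr mul0r.
  have sr : abep_slope x i.+1 = 0.
    by rewrite /abep_slope (tail_energyS x (bond_right i)) /= xr add0r subrr mul0r.
  rewrite (D_ABEP_bondE _ _ i) sl sr s0 -/rest /n.
  case: (tnth xi (bond_left i)) => [|r]; last first.
    by rewrite addSn !exprS !(mul0r, mulr0) subrr.
  case: (tnth xi (bond_right i)) => [|r].
    by rewrite !rise0 !expr0 !divr1 !mul1r subrr.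
  by rewrite add0n !exprS !(mul0r, mulr0) subrr.
have E0 : 0 < E by rewrite lt_def E_neq0.
(* [C] is the part of the redistributed duality function that does not depend on [w]. *)
pose C := scale x i ^+ n / (rise (2 * k) (tnth xi (bond_left i)) *
  rise (2 * k) (tnth xi (bond_right i))) * rest.
have -> : scale x i ^+ n / rise (4 * k) n * rest = C *
   (rise (2 * k) (tnth xi (bond_left i)) *
    rise (2 * k) (tnth xi (bond_right i)) / rise (4 * k) n).
  rewrite /C; field; rewrite !rise2_neq0 gt_eqF// rise_gt0// mulr_gt0//.
rewrite -(nu_ABEP_moment sigma0 k0 E0).
apply: eq_Rintegral => w _; congr ((_ - _) * _).
have [sl sr] := slope_split (x := x) (i := i) w E0.
rewrite (D_ABEP_bondE _ _ i) sl sr [(_ * abep_curve _ _ _) ^+ _]exprMn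
  [(_ * (1 - abep_curve _ _ _)) ^+ _]exprMn.
rewrite [\prod_(j < L | _) _](_ : _ = rest).
  by rewrite /C /n exprD; field; rewrite !rise2_neq0.
apply: eq_bigr => j /andP[jl jr]; congr (_ ^+ _ / _).
have wE : w * E + (1 - w) * E = tnth x (bond_left i) + tnth x (bond_right i).
  by rewrite -/E; ring.
by rewrite /abep_slope !tail_energy_set_bond.
Qed.

Lemma abep_generator_dual x xi : nonneg_configs x ->
  ABEP_generator sigma k (D_ABEP sigma k ^~ xi) x =
  particle_generator (nu_SIP k) (D_ABEP sigma k x) xi.
Proof. by move=> x0; apply: eq_bigr => i _; exact: abep_bond_dual. Qed.

(** Each slope lies between 0 and the inverse of [2 * sigma], because the exponentials lie between 0
    and 1. *)
Lemma D_ABEP_bounded xi : exists M : R, forall x : L.-tuple R,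
  nonneg_configs x -> `|D_ABEP sigma k x xi| <= M.
Proof.
exists (\prod_(j < L) ((2 * sigma)^-1 ^+ tnth xi j / rise (2 * k) (tnth xi j))).
move=> x x0; rewrite D_ABEPE.
have s2 : 0 < 2 * sigma by rewrite mulr_gt0.
have slope_ge0 (j : 'I_L) : 0 <= abep_slope x j.
  rewrite divr_ge0 ?(ltW s2)// subr_ge0 ler_expR lerN2 ler_wpM2l ?(ltW s2)//.
  by rewrite tail_energyS lerDr.
have slope_le (j : 'I_L) : abep_slope x j <= (2 * sigma)^-1.
  rewrite ler_piMl ?invr_ge0 ?(ltW s2)// lerBlDr ler_wpDr ?expR_ge0//.
  by rewrite -[leRHS]expR0 ler_expR oppr_le0 mulr_ge0 ?(ltW s2)// tail_energy_ge0.
have r0 n : 0 <= (rise (2 * k) n)^-1 by rewrite invr_ge0 ltW// rise_gt0.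
rewrite ger0_norm; last by apply: prodr_ge0 => j _; rewrite mulr_ge0// exprn_ge0.
apply: ler_prod => j _; rewrite mulr_ge0 ?exprn_ge0//=.
by rewrite ler_wpM2r// lerXn2r ?nnegrE// invr_ge0 ltW.
Qed.

Lemma measurable_D_ABEP xi :
  measurable_fun [set: L.-tuple R] (fun x => D_ABEP sigma k x xi).
Proof.
have mt j : measurable_fun [set: L.-tuple R] (tail_energy ^~ j).
  under eq_fun do rewrite /tail_energy big_mkcond.
  apply: measurable_sum => l; case: (j <= l)%N; last exact: measurable_cst.
  exact: measurable_tnth.
have me j : measurable_fun [set: L.-tuple R]
    (fun x => expR (- (2 * sigma * tail_energy x j))).
  apply: measurableT_comp => //; apply: measurableT_comp => //.
  by apply: measurable_funM => //; exact: mt.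
under eq_fun do rewrite D_ABEPE.
apply: measurable_prod => j _; apply: measurable_funM => //.
apply: measurable_funX; apply: measurable_funM => //.
by apply: measurable_funB; exact: me.
Qed.

End AbepDuality.

(** * Main theorem *)

Lemma measurable_nonneg_configs (R : realType) (L : nat) :
  measurable (@nonneg_configs R L).
Proof.
have -> : @nonneg_configs R L =
    \bigcap_(i in [set: 'I_L]) [set x : L.-tuple R | 0 <= tnth x i].
  by apply/seteqP; split => x x0 i; [move=> _; exact: x0|exact: x0].
apply: fin_bigcap_measurable => [|i _]; first exact: finite_finset.
have := measurable_tnth i measurableT (measurable_itv `[(0 : R), +oo[).
rewrite setTI; congr measurable; apply/seteqP.
by split => x /=; rewrite in_itv /= andbT.
Qed.

Lemma particle_generatorZ (R : realType) (L : nat) (nu : nat -> nat -> R) (c : R)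
    (f : L.-tuple nat -> R) y :
  particle_generator nu (fun z => c * f z) y = c * particle_generator nu f y.
Proof.
rewrite /particle_generator mulr_sumr; apply: eq_bigr => i _.
by rewrite mulr_sumr; apply: eq_bigr => r _; rewrite -mulrBr mulrA.
Qed.

Theorem asip_dual (R : realType) (q k : R) (L : nat) (q0 : 0 < q) (q1 : q < 1)
    (k0 : 0 < k) (X Y : markov_process R [set: L.-tuple nat]) :
  is_ThASIP q k X -> is_ThASIP q k Y -> dual_with X Y (D_ASIP q k).
Proof.
move=> [_ GX] [_ GY] x y t _ _ t0.
have [iX EX] := expectation_shell GX (D_ASIP q k ^~ y) (erefl (total x)) t0.
have [iY EY] := expectation_shell GY (D_ASIP q k x) (erefl (total y)) t0.
split => //; rewrite EX EY; congr EFin.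
(* [D_ASIP] is unbounded, hence the cut-off outside the conserved shell. *)
pose D (z1 z2 : L.-tuple nat) : R := (total z1 == total x)%:R * D_ASIP q k z1 z2.
have DM z2 : exists M : R, forall z1, [set: L.-tuple nat] z1 -> `|D z1 z2| <= M.
  exists (\sum_(j : shell_type (total x)) `|D_ASIP q k (shell_val j) z2|) => z1 _.
  rewrite /D; case: eqP => [/shell_valP[j <-]|_].
    by rewrite mul1r (bigD1 j)//= lerDl sumr_ge0.
  by rewrite mul0r normr0 sumr_ge0.
transitivity (markov_op X t (D ^~ y) x).
  rewrite (markov_op_shell GX _ (erefl (total x)) t0); apply: eq_bigr => j _.
  by rewrite /D total_shell_val eqxx mul1r.
transitivity (markov_op Y t (D x) y); last first.
  rewrite (markov_op_shell GY _ (erefl (total y)) t0); apply: eq_bigr => j _.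
  by rewrite /D eqxx mul1r.
apply: (generator_duality measurableT GX GY (N := total y)) => //.
- by move=> z _; exact: measurable_fun_tuple_nat.
(* The cut-off factor passes through the generator of [X] by conservation, and is a constant for
   that of [Y]. *)
- move=> z1 z2 _ _; rewrite /D particle_generator_conserved.
  by rewrite particle_generatorZ asip_generator_dual.
Qed.

(** For each dual configuration [D_ABEP] is bounded in the energies, so [generator_duality] applies
    to it directly; [Y] is confined to a finite shell. *)
Theorem abep_dual (R : realType) (sigma k : R) (L : nat) (sigma0 : 0 < sigma)
    (k0 : 0 < k) (X : markov_process R (@nonneg_configs R L))
    (Y : markov_process R [set: L.-tuple nat]) :
  is_ThABEP sigma k X -> is_ThSIP k Y -> dual_with X Y (D_ABEP sigma k).
Proof.
move=> [_ GX] [_ GY] x y t Sx _ t0.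
have mS := @measurable_nonneg_configs R L.
have [iY EY] := expectation_shell GY (D_ABEP sigma k x) (erefl (total y)) t0.
have mD z : measurable_fun (@nonneg_configs R L) (D_ABEP sigma k ^~ z).
  by apply: measurable_funTS; exact: measurable_D_ABEP.
have [M DM] := D_ABEP_bounded sigma0 k0 y.
split => //; first exact: (integrable_comp_path mS x (ltW t0) (mD y) DM).
rewrite (expectation_comp_path mS x (ltW t0) (mD y) DM) EY.
rewrite -(markov_op_shell GY _ (erefl (total y)) t0); congr EFin.
apply: (generator_duality mS GX GY (N := total y)) => //.
- by move=> z _; exact: D_ABEP_bounded.
- by move=> z1 z2 Sz1 _; exact: abep_generator_dual.
Qed.

Theorem theorem5p3 (R : realType) (q sigma k : R) (L : nat)
    (hq0 : 0 < q) (hq1 : q < 1) (hsigma : 0 < sigma) (hk : 0 < k)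
    (hL : (2 <= L)%N) :
  (forall X Y : markov_process R [set: L.-tuple nat],
     is_ThASIP q k X -> is_ThASIP q k Y -> dual_with X Y (D_ASIP q k)) /\
  (forall (X : markov_process R (@nonneg_configs R L))
          (Y : markov_process R [set: L.-tuple nat]),
     is_ThABEP sigma k X -> is_ThSIP k Y -> dual_with X Y (D_ABEP sigma k)).
Proof. by split => X Y; [exact: asip_dual|exact: abep_dual]. Qed.
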